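(* The partitions of $AG(4,3)$ into four mutually disjoint maximal caps together with their common anchor point fall into exactly two equivalence classes under the action of the affine group $\mathit{Aff}(4,3)$. In each such partition the four caps split into two pairs that are either both 1-completable pairs or both 2-completable pairs; one equivalence class consists of the partitions with two 1-completable pairs, and the other consists of the partitions with two 2-completable pairs.
   Context: $AG(4,3)$ is $\mathbb{F}_3^4$; lines are sets $\{\vec{x},\vec{y},\vec{z}\}$ of three distinct points with $\vec{x}+\vec{y}+\vec{z}=\vec{0}$ mod 3. A cap is a set with no three collinear points; a maximal cap is a cap of largest size (20 points). Every maximal cap $S$ has a unique anchor point $\vec{a}\notin S$: $S$ is a union of 10 pairs of points each forming a line with $\vec{a}$. A partition (with anchor $\vec{a}$) is a collection $\{\{\vec{a}\},A,B,C,D\}$ of mutually disjoint maximal caps $A,B,C,D$ each with anchor $\vec{a}$, whose union with $\{\vec{a}\}$ is $AG(4,3)$. A pair $\{X,Y\}$ of disjoint maximal caps with a common anchor is a 1-completable pair (resp. 2-completable pair) if it is contained in exactly one (resp. exactly two) partitions. $\mathit{Aff}(4,3)=GL(4,3)\ltimes\mathbb{F}_3^4$ acts by $\vec{v}\mapsto A\vec{v}+\vec{b}$, mapping caps to caps and partitions to partitions. *)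

(* Defs.v *)
From mathcomp Require Import all_boot all_algebra all_fingroup.

Set Implicit Arguments.
Unset Strict Implicit.
Unset Printing Implicit Defensive.

Import GRing.Theory.
Local Open Scope ring_scope.

Notation AG43 := 'cV['F_3]_4.

Definition is_line (L : {set AG43}) : bool :=
  (#|L| == 3)%N && (\sum_(v in L) v == 0).

Definition is_cap (S : {set AG43}) : bool :=
  [forall L : {set AG43}, is_line L ==> ~~ (L \subset S)].

(* A cap of largest size, not merely one maximal under inclusion. *)
Definition is_maxcap (S : {set AG43}) : bool :=
  is_cap S && [forall T : {set AG43}, is_cap T ==> (#|T| <= #|S|)%N].

(* The conditions #|p| = 2 and is_line (a |: p) together force a \notin p. *)
Definition is_anchor (a : AG43) (S : {set AG43}) : bool :=
  (a \notin S) &&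
  [exists Q : {set {set AG43}},
    [&& (#|Q| == 10)%N,
        [forall p in Q, (#|p| == 2)%N && is_line (a |: p)] &
        cover Q == S]].

Definition is_cap_partition (a : AG43) (P : {set {set AG43}}) : bool :=
  [&& partition P [set: AG43],
      [set a] \in P,
      (#|P :\ [set a]| == 4)%N &
      [forall X in P :\ [set a], is_maxcap X && is_anchor a X]].

Definition cap_partitions : {set {set {set AG43}}} :=
  [set P | [exists a, is_cap_partition a P]].

Definition completable_pair (k : nat) (X Y : {set AG43}) : bool :=
  [&& is_maxcap X, is_maxcap Y, [disjoint X & Y],
      [exists a, is_anchor a X && is_anchor a Y] &
      #|[set P in cap_partitions | [set X; Y] \subset P]| == k].

(* The blocks X, Y, Z, W are automatically pairwise distinct and different
   from [set a], since P has exactly four blocks other than [set a]. *)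
Definition splits_into_completable_pairs (k : nat) (P : {set {set AG43}})
    : Prop :=
  exists (a : AG43) (X Y Z W : {set AG43}),
    [/\ is_cap_partition a P,
        P = [set [set a]; X; Y; Z; W],
        completable_pair k X Y &
        completable_pair k Z W].

(* Aff(4,3), realised as the group of permutations v |-> A v + b of AG(4,3). *)
Definition Aff43 : {set {perm AG43}} :=
  [set s : {perm AG43} |
    [exists A : 'M['F_3]_4, exists b : AG43,
      (A \in unitmx) && [forall v, s v == A *m v + b]]].

Lemma Aff43_group_set : group_set Aff43.
Proof.
apply/group_setP; split=> [|s t].
  rewrite inE; apply/existsP; exists 1%:M; apply/existsP; exists 0.
  by rewrite unitmx1; apply/forallP => v; rewrite perm1 mul1mx addr0.
rewrite !inE => /existsP[A /existsP[b /andP[uA /forallP sE]]].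
move=> /existsP[B /existsP[c /andP[uB /forallP tE]]].
apply/existsP; exists (B *m A); apply/existsP; exists (B *m b + c).
rewrite unitmx_mul uA uB; apply/forallP => v.
by rewrite permM (eqP (tE _)) (eqP (sE _)) mulmxDr mulmxA addrA.
Qed.

Canonical Aff43_group := Group Aff43_group_set.

(* 'P is the action of {perm AG43} on points; each ^* lifts it by direct image,
   first to sets of points and then to sets of sets of points. *)
Definition Aff43_class (P : {set {set AG43}}) : {set {set {set AG43}}} :=
  orbit ('P^*^*)%act Aff43 P.

Definition cap_partition_classes : {set {set {set {set AG43}}}} :=
  [set Aff43_class P | P in cap_partitions].

(* Main.v *)
(* Put the anchor at 0. A maximal cap with anchor 0 is then closed under
   v |-> -v, so it is the cone over a 10-cap of PG(3,3) (an ovoid, in fact an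
   elliptic quadric), and a partition is a partition of the 40 points of PG(3,3)
   into four ovoids.

   No cap of AG(4,3) has more than 20 points. A nonzero linear form u on F_3^n
   splits a cap S into three slices, which are caps of AG(n-1,3). If b_k(u) is
   the number of k-subsets of S inside a slice, double counting yields
     sum_u b_2(u) = C(|S|,2) (3^(n-1) - 1), sum_u b_3(u) = C(|S|,3) (3^(n-2) - 1),
   because two points of S, and three points of S, are affinely independent. The
   first sum bounds caps by 4 in the plane and by 9 in space. For 21 points of
   AG(4,3) with slices of at most 9 points, 16 b_2 <= 3 b_3 + 693, and the two
   sums force equality for all 80 forms; then b_2(u) is 63 or 75, and 75 occurs
   35 times. But 35 is odd, whereas b_2(u) = b_2(-u).

   An ovoid is not contained in a hyperplane, so it can be moved to one through
   the standard basis; the signed permutation matrices move each ovoid through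
   the basis to a fixed one. A search lists the partitions containing that ovoid,
   and its symmetries move each of them to one of two partitions, in which the
   pairs it forms with the other blocks lie in 1, 6, 6 and in 2, 6, 6
   partitions. *)
Require Import Defs.
From HB Require Import structures.
From mathcomp Require Import all_boot all_algebra all_fingroup.
From mathcomp Require Import mxabelem zify ring.

Set Implicit Arguments.
Unset Strict Implicit.
Unset Printing Implicit Defensive.

Import GRing.Theory.
Local Open Scope ring_scope.

Lemma subset_of_card (T : finType) (A : {set T}) (m : nat) :
  (m <= #|A|)%N -> exists2 B : {set T}, B \subset A & #|B| = m.
Proof.
move=> /card_geqP[s [s_uniq <- /subsetP sA]]; exists [set x in s].
  by apply: subset_trans sA; apply/subsetP => x; rewrite inE.
by rewrite cardsE; apply/card_uniqP.
Qed.

Lemma imset_setD1 (aT rT : finType) (f : aT -> rT) (A : {set aT}) (x : aT) :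
  injective f -> f @: (A :\ x) = (f @: A) :\ f x.
Proof.
move=> f_inj; apply/setP => y; apply/imsetP/setD1P.
  by move=> [z /setD1P[zx zA] ->]; rewrite (inj_eq f_inj) imset_f.
move=> [yfx /imsetP[z zA y_eq]]; exists z => //; rewrite !inE zA andbT.
by apply: contraNneq yfx => <-; rewrite y_eq.
Qed.

Lemma cards3P (T : finType) (A : {set T}) :
  reflect (exists x y z, [/\ x != y, y != z, x != z & A = x |: [set y; z]])
          (#|A| == 3%N).
Proof.
apply: (iffP eqP) => [card3 | [x [y [z [xy yz xz ->]]]]]; last first.
  by rewrite cardsU1 !inE negb_or xy xz cards2 yz.
have [x xA] : exists x, x \in A by apply/card_gt0P; rewrite card3.
have : #|A :\ x| == 2%N by move: card3; rewrite (cardsD1 x) xA => /succn_inj->.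
case/cards2P => y [z [yz Ax]]; exists x, y, z.
have : x \notin [set y; z] by rewrite -Ax setD11.
by rewrite in_set2 negb_or -Ax setD1K // => /andP[-> ->]; split.
Qed.

Section OrbitPairs.

Variables (T : finType) (r : T -> T) (S : {set T}).
Hypotheses (r_invol : involutive r) (r_stable : {in S, forall x, r x \in S}).

Definition orbit_pairs : {set {set T}} := [set [set x; r x] | x in S].

Lemma orbit_pairs_partition : partition orbit_pairs S.
Proof.
have pairE x y : x \in [set y; r y] -> [set y; r y] = [set x; r x].
  by rewrite !inE => /orP[] /eqP-> //; rewrite r_invol setUC.
apply/and3P; split.
- rewrite eqEsubset; apply/andP; split; apply/subsetP => x.
    case/bigcupP => _ /imsetP[y yS ->].
    by rewrite !inE => /orP[] /eqP-> //; apply: r_stable.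
  by move=> xS; apply/bigcupP; exists [set x; r x]; [exact: imset_f | exact: set21].
- apply/trivIsetP => _ _ /imsetP[x _ ->] /imsetP[y _ ->]; apply: contraR.
  by move=> /pred0Pn[z /andP[/= /pairE-> /pairE->]].
by apply/imsetP => -[x _ /setP/(_ x)]; rewrite !inE eqxx.
Qed.

Hypothesis r_free : {in S, forall x, r x != x}.

Lemma card_orbit_pair : {in orbit_pairs, forall p : {set T}, #|p| = 2%N}.
Proof. by move=> _ /imsetP[x xS ->]; rewrite cards2 eq_sym r_free. Qed.

Lemma card_orbit_pairs : #|S| = (#|orbit_pairs| * 2)%N.
Proof. exact: card_uniform_partition card_orbit_pair orbit_pairs_partition. Qed.

End OrbitPairs.

Lemma F3_cases (c : 'F_3) : [\/ c = 0, c = 1 | c = -1].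
Proof.
by case: c => -[|[|[|n]]] lt_c //; [apply: Or31 | apply: Or32 | apply: Or33];
   apply: val_inj.
Qed.

Lemma addr3_F3 m n (A : 'M['F_3]_(m, n)) : A + A + A = 0.
Proof.
apply/matrixP => i j; rewrite !mxE.
by case: (F3_cases (A i j)) => ->; apply: val_inj.
Qed.

Lemma addrr_F3 m n (A : 'M['F_3]_(m, n)) : A + A = - A.
Proof. by apply/eqP; rewrite -addr_eq0 addr3_F3. Qed.

Lemma eq_third_F3 m n (A B : 'M['F_3]_(m, n)) : (A == - (A + B)) = (A == B).
Proof. by rewrite -addr_eq0 addrA -(addr3_F3 A) (inj_eq (addrI _)) eq_sym. Qed.

Lemma even_card_symmetric m n (E : {set 'M['F_3]_(m, n)}) :
  {in E, forall A, A != 0 /\ - A \in E} -> ~~ odd #|E|.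
Proof.
move=> E_sym; rewrite (card_orbit_pairs (@opprK _)) ?oddM ?andbF //.
  by move=> A /E_sym[].
by move=> A /E_sym[A0 _]; rewrite eq_sym -addr_eq0 addrr_F3 oppr_eq0.
Qed.

Lemma card_solutions (F : finFieldType) n k (A : 'M[F]_(n, k)) :
  #|[set u : 'rV_n | u *m A == 0]| = (#|F| ^ (n - \rank A))%N.
Proof.
rewrite -mxrank_ker -card_rowg; apply: eq_card => u.
by rewrite inE mem_rowg; apply/eqP/sub_kermxP.
Qed.

(** * Caps of AG(n,3) *)

Definition capset n (S : {set 'cV['F_3]_n}) : Prop :=
  {in S & &, forall x y z, x != y -> y != z -> x != z -> x + y + z != 0}.

Lemma capset_sub n (S T : {set 'cV['F_3]_n}) : S \subset T -> capset T -> capset S.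
Proof. by move=> /subsetP sST capT x y z /sST xT /sST yT /sST; apply: capT. Qed.

Lemma capset_imset m n (f : 'cV['F_3]_m -> 'cV['F_3]_n) (S : {set 'cV['F_3]_m}) :
    {in S & &, forall x y z, f x + f y + f z = 0 -> x + y + z = 0} ->
  capset S -> capset (f @: S).
Proof.
move=> f_sum3 capS _ _ _ /imsetP[x xS ->] /imsetP[y yS ->] /imsetP[z zS ->] xy yz xz.
apply: contra_neq (capS _ _ _ xS yS zS _ _ _); first exact: f_sum3.
- by apply: contraNneq xy => ->.
- by apply: contraNneq yz => ->.
by apply: contraNneq xz => ->.
Qed.

Definition slice n (S : {set 'cV['F_3]_n}) (u : 'rV_n) (c : 'F_3) : {set 'cV_n} :=
  [set x in S | (u *m x) 0 0 == c].

Lemma slice_sub n (S : {set 'cV['F_3]_n}) u c : slice S u c \subset S.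
Proof. by apply/subsetP => x; rewrite inE => /andP[]. Qed.

Lemma sum_card_slice n (S : {set 'cV['F_3]_n}) (u : 'rV_n) :
  (\sum_c #|slice S u c| = #|S|)%N.
Proof.
rewrite -sum1_card (partition_big (fun x : 'cV_n => (u *m x) 0 0) xpredT) //=.
by apply: eq_bigr => c _; rewrite -sum1_card; apply: eq_bigl => x; rewrite inE.
Qed.

(* Dropping a coordinate j with u_j != 0 is injective on the hyperplanes of
   equation u x = c. *)
Lemma card_capset_slice n b (S : {set 'cV['F_3]_n.+1}) (u : 'rV_n.+1) (c : 'F_3) :
    (forall T : {set 'cV['F_3]_n}, capset T -> #|T| <= b)%N ->
    u != 0 -> capset S -> (#|slice S u c| <= b)%N.
Proof.
move=> le_b /rV0Pn[j uj0] capS.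
have ker0 (w : 'cV_n.+1) : (u *m w) 0 0 = 0 -> row' j w = 0 -> w = 0.
  move=> uw0 w'0; have w_off i : i != j -> w i 0 = 0.
    by case: (unliftP j i) => [k -> _ | -> /eqP//]; have /colP/(_ k) := w'0; rewrite !mxE.
  apply/colP => i; rewrite mxE; have [->|/w_off//] := eqVneq i j.
  move: uw0; rewrite mxE (bigD1 j) //= big1 ?addr0 => [/eqP|k kj].
    by rewrite mulf_eq0 (negPf uj0) => /eqP.
  by rewrite w_off ?mulr0.
have sliceE x : x \in slice S u c -> (u *m x) 0 0 = c by rewrite inE => /andP[_ /eqP].
have inj_row' : {in slice S u c &, injective (row' j : 'cV_n.+1 -> 'cV_n)}.
  move=> x y xH yH xy; apply/eqP; rewrite -subr_eq0; apply/eqP/ker0.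
    by rewrite mulmxBr mxE [X in _ + X]mxE !sliceE ?subrr.
  by rewrite linearB /= xy subrr.
rewrite -(card_in_imset inj_row'); apply/le_b/capset_imset.
  move=> x y z xH yH zH sum0; apply: ker0; last by rewrite !linearD.
  rewrite !mulmxDr mxE [X in X + _]mxE !sliceE //.
  by case: (F3_cases c) => ->; apply: val_inj.
exact: capset_sub (slice_sub S u c) capS.
Qed.

Definition constant_forms n (S : {set 'cV['F_3]_n}) : {set 'rV['F_3]_n} :=
  [set u | [forall x in S, forall y in S, u *m x == u *m y]].

Lemma mem_constant_forms n (S : {set 'cV['F_3]_n}) x u : x \in S ->
  (u \in constant_forms S) = [forall y in S, u *m (y - x) == 0].
Proof.
move=> xS; rewrite inE; apply/forall_inP/forall_inP => const_u y yS.
  by rewrite mulmxBr subr_eq0; have /forall_inP := const_u y yS; apply.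
apply/forall_inP => z zS; have := const_u z zS; have := const_u y yS.
by rewrite !mulmxBr !subr_eq0 => /eqP-> /eqP->.
Qed.

Lemma sum_subset_slice n (A : {set 'cV['F_3]_n}) (u : 'rV_n) : A != set0 ->
  (\sum_c (A \subset slice A u c) = (u \in constant_forms A))%N.
Proof.
case/set0Pn => x xA; rewrite (bigD1 ((u *m x) 0 0)) //= big1 ?addn0 => [|c ux_c].
  congr nat_of_bool; apply/subsetP/idP => [A_slice|].
    rewrite inE; apply/forall_inP => y yA; apply/forall_inP => z zA.
    apply/eqP/rowP => i.
    have /[!inE] /andP[_ /eqP uy] := A_slice y yA.
    by have /[!inE] /andP[_ /eqP uz] := A_slice z zA; rewrite ord1 uy uz.
  rewrite inE => /forall_inP/(_ _ xA)/forall_inP u_const y yA.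
  by rewrite inE yA (eqP (u_const _ yA)) eqxx.
apply/eqP; rewrite eqb0; apply: contra ux_c => /subsetP/(_ x xA).
by rewrite inE eq_sym => /andP[].
Qed.

Definition slice_subsets n (S : {set 'cV['F_3]_n}) (k : nat) (u : 'rV_n) : nat :=
  \sum_c 'C(#|slice S u c|, k).

Lemma sum_slice_subsets n (S : {set 'cV['F_3]_n}) (k q : nat) : (0 < k)%N ->
    (forall A : {set 'cV_n}, A \subset S -> #|A| = k -> #|constant_forms A| = q) ->
  (\sum_(u : 'rV_n | u != 0%R) slice_subsets S k u = 'C(#|S|, k) * (q - 1))%N.
Proof.
move=> k_gt0 card_forms.
pose draws := [set A : {set 'cV['F_3]_n} | A \subset S & #|A| == k].
have bin_slice (u : 'rV_n) c :
    'C(#|slice S u c|, k) = (\sum_(A in draws) (A \subset slice A u c))%N.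
  rewrite -cards_draws -sum1_card -big_mkcondr; apply: eq_bigl => A; rewrite !inE.
  case: (boolP (A \subset S)) => [/subsetP AS | /negPf nAS] /=; last first.
    by apply/negP => /andP[/subset_trans/(_ (slice_sub S u c))]; rewrite nAS.
  rewrite andbC; congr andb; apply/subsetP/subsetP => A_slice x xA;
    by have := A_slice x xA; rewrite !inE xA AS.
rewrite /slice_subsets.
under eq_bigr do (under eq_bigr do rewrite bin_slice; rewrite exchange_big).
rewrite exchange_big -(cards_draws S) -sum_nat_const; apply: eq_bigr => A.
rewrite inE => /andP[AS /eqP cardA].
have A0 : A != set0 by rewrite -card_gt0 cardA.
under eq_bigr do rewrite sum_subset_slice //.
rewrite -big_mkcondr -(card_forms A) // (cardsD1 0) /=.
have -> : (0 \in constant_forms A) = true.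
  by rewrite inE; apply/forall_inP => x _; apply/forall_inP => y _; rewrite !mul0mx.
by rewrite addKn -sum1_card; apply: eq_bigl => u; rewrite in_setD1.
Qed.

Lemma card_constant_forms2 n (x y : 'cV['F_3]_n) :
  x != y -> #|constant_forms [set x; y]| = (3 ^ n.-1)%N.
Proof.
move=> xy; have rank1 : \rank (y - x) = 1%N.
  by apply/eqP; rewrite eqn_leq rank_leq_col lt0n mxrank_eq0 subr_eq0 eq_sym.
have := card_solutions (y - x); rewrite card_Fp // rank1 subn1 => <-.
apply: eq_card => u; rewrite (mem_constant_forms _ (set21 x y)) inE.
apply/forall_inP/idP => [|uyx z]; first by apply; rewrite set22.
by rewrite !inE => /orP[] /eqP->; rewrite ?subrr ?mulmx0.
Qed.

Lemma rank_row_mx_F3 n (a b : 'cV['F_3]_n) :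
  a != 0 -> b != 0 -> a != b -> a != - b -> \rank (row_mx a b) = 2%N.
Proof.
move=> a0 b0 ab aNb; apply/eqP; rewrite -mxrank_tr -/(row_free _).
apply: inj_row_free => v; rewrite -[v]hsubmxK tr_row_mx mul_row_col.
rewrite [lsubmx v]mx11_scalar [rsubmx v]mx11_scalar !mul_scalar_mx -!linearZ -linearD /=.
move=> /(congr1 trmx); rewrite trmxK trmx0 => lin_rel.
have /and3P[/eqP sum_neq0 /eqP diff_neq0 /eqP diffN_neq0] :
    [&& a + b != 0, a - b != 0 & - a + b != 0].
  by rewrite addr_eq0 aNb subr_eq0 ab addrC subr_eq0 eq_sym.
have [s0 t0] : lsubmx v 0 0 = 0 /\ rsubmx v 0 0 = 0.
  move: lin_rel; case: (F3_cases (lsubmx v 0 0)) => ->;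
    case: (F3_cases (rsubmx v 0 0)) => ->;
    rewrite ?scale0r ?scale1r ?scaleN1r ?add0r ?addr0 -?opprD // => /eqP;
    by rewrite ?oppr_eq0 ?(negPf a0) ?(negPf b0) // => /eqP.
by rewrite s0 t0 raddf0 row_mx0.
Qed.

Lemma card_constant_forms3 n (x y z : 'cV['F_3]_n) :
    x != y -> y != z -> x != z -> x + y + z != 0 ->
  #|constant_forms (x |: [set y; z])| = (3 ^ n.-2)%N.
Proof.
move=> xy yz xz xyz; have rank2 : \rank (row_mx (y - x) (z - x)) = 2%N.
  apply: rank_row_mx_F3; rewrite ?subr_eq0 ?(inj_eq (addIr _)) // 1?eq_sym //.
  rewrite eq_sym -addr_eq0; apply: contraNneq xyz => yzx; apply/eqP.
  have -> : x + y + z = y - x + (z - x) + (x + x + x).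
    by apply/colP => i; rewrite !mxE; ring.
  by rewrite yzx addr3_F3 addr0.
have := card_solutions (row_mx (y - x) (z - x)); rewrite card_Fp // rank2 subn2 => <-.
apply: eq_card => u.
rewrite (mem_constant_forms _ (setU11 x _)) inE mul_mx_row row_mx_eq0.
apply/forall_inP/andP => [u0 | [uyx uzx] w]; first by rewrite !u0 // !inE eqxx ?orbT.
rewrite !inE => /or3P[/eqP->|/eqP->|/eqP->].
all: by rewrite ?subrr ?mulmx0 ?uyx ?uzx.
Qed.

Lemma sum_slice_pairs n (S : {set 'cV['F_3]_n}) :
  (\sum_(u : 'rV_n | u != 0%R) slice_subsets S 2 u =
   'C(#|S|, 2) * (3 ^ n.-1 - 1))%N.
Proof.
apply: sum_slice_subsets => // A _ /eqP/cards2P[x [y [xy ->]]].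
exact: card_constant_forms2.
Qed.

Lemma sum_slice_triples n (S : {set 'cV['F_3]_n}) : capset S ->
  (\sum_(u : 'rV_n | u != 0%R) slice_subsets S 3 u =
   'C(#|S|, 3) * (3 ^ n.-2 - 1))%N.
Proof.
move=> capS; apply: sum_slice_subsets => // A /subsetP AS /eqP/cards3P.
move=> [x [y [z [xy yz xz A_eq]]]]; rewrite A_eq card_constant_forms3 // capS //.
all: by apply: AS; rewrite A_eq !inE eqxx ?orbT.
Qed.

Lemma all_iota3 (n : nat) (p : nat -> nat -> nat -> bool) :
    all (fun a => all (fun b => all (p a b) (iota 0 n)) (iota 0 n)) (iota 0 n) ->
  forall a b c, (a < n)%N -> (b < n)%N -> (c < n)%N -> p a b c.
Proof.
have mem_n i : (i < n)%N -> i \in iota 0 n by rewrite mem_iota.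
by move=> /allP p_n a b c /mem_n/p_n/allP p_a /mem_n/p_a/allP p_b /mem_n/p_b.
Qed.

Lemma sum_F3 (f : 'F_3 -> nat) : (\sum_c f c = f 0%R + f 1%R + f (-1)%R)%N.
Proof.
rewrite !big_ord_recl big_ord0 addn0 addnA.
by congr (f _ + f _ + f _)%N; apply: val_inj.
Qed.

Lemma card_nonzero_forms n : #|[pred u : 'rV['F_3]_n | u != 0]| = (3 ^ n - 1)%N.
Proof.
have := cardC1 (0 : 'rV['F_3]_n); rewrite card_mx card_Fp // mul1n subn1 => <-.
exact: eq_card.
Qed.

Definition split3_pairs_le (b m w : nat) : bool :=
  all (fun x => all (fun y => all (fun z =>
    (x + y + z == m)%N ==> ('C(x, 2) + 'C(y, 2) + 'C(z, 2) <= w)%N)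
      (iota 0 b.+1)) (iota 0 b.+1)) (iota 0 b.+1).

Lemma slice_pairs_le n (b m w : nat) (S : {set 'cV['F_3]_n}) (u : 'rV_n) :
    split3_pairs_le b m w -> #|S| = m -> (forall c, #|slice S u c| <= b)%N ->
  (slice_subsets S 2 u <= w)%N.
Proof.
move=> /all_iota3 le_w cardS le_b; rewrite /slice_subsets sum_F3.
apply: (implyP (le_w _ _ _ _ _ _)); rewrite ?ltnS //.
by rewrite -cardS -(sum_card_slice S u) sum_F3.
Qed.

Lemma card_capset_step n (b m w : nat) :
    (forall S : {set 'cV['F_3]_n}, capset S -> #|S| <= b)%N ->
    split3_pairs_le b m w -> ((3 ^ n.+1 - 1) * w < 'C(m, 2) * (3 ^ n - 1))%N ->
  forall S : {set 'cV['F_3]_n.+1}, capset S -> (#|S| < m)%N.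
Proof.
move=> le_b le_w lt_pairs T capT.
rewrite ltnNge; apply/negP => /subset_of_card[S /capset_sub/(_ capT) capS cardS].
have := sum_slice_pairs S; rewrite cardS => sum_pairs.
move: lt_pairs; apply/negP; rewrite -leqNgt -sum_pairs.
rewrite -card_nonzero_forms -sum_nat_const.
apply: leq_sum => u u0; apply: slice_pairs_le le_w cardS _ => c.
exact: card_capset_slice le_b u0 capS.
Qed.

Lemma card_capset_line (S : {set 'cV['F_3]_1}) : capset S -> (#|S| <= 2)%N.
Proof.
move=> capS; rewrite leqNgt; apply/negP => card_gt2.
have S_all x : x \in S.
  suff -> : S = setT by rewrite inE.
  by apply/eqP; rewrite eqEcard subsetT cardsT card_mx card_Fp.
have c_neq (a b : 'F_3) : (const_mx a == const_mx b :> 'cV_1) = (a == b).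
  by apply/eqP/eqP => [/colP/(_ 0)|->//]; rewrite !mxE.
have := capS _ _ _ (S_all (const_mx 0)) (S_all (const_mx 1)) (S_all (const_mx (-1))).
rewrite !c_neq => /(_ isT isT isT) /eqP[].
by apply/colP => i; rewrite !mxE; apply: val_inj.
Qed.

Lemma card_capset_plane (S : {set 'cV['F_3]_2}) : capset S -> (#|S| <= 4)%N.
Proof. by move/(card_capset_step (m := 5) (w := 2) card_capset_line); apply. Qed.

Lemma card_capset_space (S : {set 'cV['F_3]_3}) : capset S -> (#|S| <= 9)%N.
Proof. by move/(card_capset_step (m := 10) (w := 13) card_capset_plane); apply. Qed.

Lemma sliceN n (S : {set 'cV['F_3]_n}) u c : slice S (- u) c = slice S u (- c).
Proof. by apply/setP => x; rewrite !inE mulNmx mxE eqr_oppLR. Qed.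

(* The equality cases are the splittings (7, 7, 7) and (9, 9, 3) of 21. *)
Lemma pairs_triples_21 (x y z : nat) :
    (x <= 9)%N -> (y <= 9)%N -> (z <= 9)%N -> (x + y + z)%N = 21%N ->
  let pairs := ('C(x, 2) + 'C(y, 2) + 'C(z, 2))%N in
  let triples := ('C(x, 3) + 'C(y, 3) + 'C(z, 3))%N in
  (16 * pairs <= 3 * triples + 693 ?= iff (pairs == 63 + 12 * (pairs == 75)))%N.
Proof.
pose p x y z := let pairs := ('C(x, 2) + 'C(y, 2) + 'C(z, 2))%N in
  let triples := ('C(x, 3) + 'C(y, 3) + 'C(z, 3))%N in
  ((x + y + z == 21) ==> (16 * pairs <= 3 * triples + 693) &&
    ((16 * pairs == 3 * triples + 693) == (pairs == 63 + 12 * (pairs == 75))))%N.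
move=> le_x le_y le_z sum21; have /implyP : p x y z.
  by apply: (@all_iota3 10 p);
     [vm_compute | exact: le_x | exact: le_y | exact: le_z].
by rewrite sum21 => /(_ isT)/andP[le_pairs /eqP eq_pairs].
Qed.

Lemma slice_pairs_21cap (S : {set 'cV['F_3]_4}) (u : 'rV_4) :
    capset S -> #|S| = 21%N -> u != 0 ->
  slice_subsets S 2 u = (63 + 12 * (slice_subsets S 2 u == 75))%N.
Proof.
move=> capS cardS u0.
have leif_triples v : v != 0 ->
    (16 * slice_subsets S 2 v <= 3 * slice_subsets S 3 v + 693
       ?= iff (slice_subsets S 2 v == 63 + 12 * (slice_subsets S 2 v == 75)))%N.
  move=> v0; rewrite /slice_subsets !sum_F3.
  apply: pairs_triples_21; rewrite ?(card_capset_slice _ card_capset_space) //.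
  by rewrite -cardS -(sum_card_slice S v) sum_F3.
have pairs : (\sum_(v : 'rV_4 | v != 0%R) 16 * slice_subsets S 2 v = 16 * (210 * 26))%N.
  have <- : (\sum_(v : 'rV_4 | v != 0%R) slice_subsets S 2 v = 210 * 26)%N.
    by rewrite sum_slice_pairs cardS.
  by rewrite big_distrr.
have triples : (\sum_(v : 'rV_4 | v != 0%R) (3 * slice_subsets S 3 v + 693) =
    3 * (1330 * 8) + 80 * 693)%N.
  rewrite big_split /= sum_nat_const card_nonzero_forms.
  have <- : (\sum_(v : 'rV_4 | v != 0%R) slice_subsets S 3 v = 1330 * 8)%N.
    by rewrite sum_slice_triples // cardS.
  by rewrite big_distrr.
suff /eqP : (\sum_(v : 'rV_4 | v != 0%R) 16 * slice_subsets S 2 v =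
    \sum_(v : 'rV_4 | v != 0%R) (3 * slice_subsets S 3 v + 693))%N.
  by rewrite (leqif_sum leif_triples) => /forall_inP/(_ u u0)/eqP.
by rewrite pairs triples; lia.
Qed.

Lemma card_capset_AG43 (S : {set 'cV['F_3]_4}) : capset S -> (#|S| <= 20)%N.
Proof.
move=> capS; rewrite leqNgt; apply/negP => /subset_of_card[T].
move=> /capset_sub/(_ capS) capT cardT.
pose E := [set u : 'rV_4 | (u != 0) && (slice_subsets T 2 u == 75)].
have : (\sum_(u : 'rV_4 | u != 0%R) slice_subsets T 2 u = 80 * 63 + 12 * #|E|)%N.
  under eq_bigr => u u0 do rewrite (slice_pairs_21cap capT cardT u0).
  rewrite big_split /= sum_nat_const card_nonzero_forms -sum1_card big_distrr /=.
  rewrite [in RHS]big_mkcond [X in (_ + X)%N]big_mkcond /=.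
  congr addn; apply: eq_bigr => u _.
  by rewrite inE; case: (u != 0) => //=; case: eqP.
rewrite sum_slice_pairs cardT => sum_pairs.
have card_E : #|E| = 35%N.
  by move: sum_pairs; rewrite -[(_ * _)%N]/(210 * 26)%N; lia.
suff /even_card_symmetric : {in E, forall u, u != 0 /\ - u \in E} by rewrite card_E.
move=> u; rewrite !inE oppr_eq0 /slice_subsets => /andP[u0 /eqP <-].
split=> //; rewrite u0 /=.
by rewrite !sum_F3 !sliceN oppr0 opprK addnAC.
Qed.

(** * Coordinates *)

Inductive trit := T0 | T1 | T2.

Definition trit_eqb (a b : trit) : bool :=
  match a, b with T0, T0 | T1, T1 | T2, T2 => true | _, _ => false end.

Lemma trit_eqP : Equality.axiom trit_eqb.
Proof. by case; case; constructor. Qed.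

HB.instance Definition _ := hasDecEq.Build trit trit_eqP.

Definition trit_add (a b : trit) : trit :=
  match a, b with
  | T0, c | c, T0 => c
  | T1, T1 => T2 | T2, T2 => T1 | _, _ => T0
  end.

Definition trit_opp (a : trit) : trit :=
  match a with T0 => T0 | T1 => T2 | T2 => T1 end.

Definition trit_mul (a b : trit) : trit :=
  match a with T0 => T0 | T1 => b | T2 => trit_opp b end.

Definition trit_val (a : trit) : 'F_3 :=
  match a with T0 => 0 | T1 => 1 | T2 => -1 end.

Definition trits : seq trit := [:: T0; T1; T2].

Definition trit_of (c : 'F_3) : trit := nth T0 trits c.

Lemma trit_valK : cancel trit_val trit_of.
Proof. by case. Qed.

Lemma trit_ofK : cancel trit_of trit_val.
Proof. by move=> c; case: (F3_cases c) => ->; apply: val_inj. Qed.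

Lemma trit_valD (a b : trit) : trit_val (trit_add a b) = trit_val a + trit_val b.
Proof. by case: a; case: b; apply: val_inj. Qed.

Lemma trit_valN (a : trit) : trit_val (trit_opp a) = - trit_val a.
Proof. by case: a; apply: val_inj. Qed.

(* A copy of AG43 made for evaluation, which the operations of 'F_3 and of
   matrices do not support. *)
Inductive point := Point of trit & trit & trit & trit.

Definition coords (x : point) : seq trit := let: Point a b c d := x in [:: a; b; c; d].

Definition point_eqb (x y : point) : bool :=
  let: Point a b c d := x in let: Point a' b' c' d' := y in
  [&& trit_eqb a a', trit_eqb b b', trit_eqb c c' & trit_eqb d d'].

Lemma point_eqP : Equality.axiom point_eqb.
Proof.
move=> [a b c d] [a' b' c' d']; apply: (iffP and4P).
  by case=> /trit_eqP-> /trit_eqP-> /trit_eqP-> /trit_eqP->.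
by case=> -> -> -> ->; split; apply/trit_eqP.
Qed.

HB.instance Definition _ := hasDecEq.Build point point_eqP.

Definition vec (x : point) : AG43 := \col_(i < 4) trit_val (nth T0 (coords x) i).

Definition point_of (v : AG43) : point :=
  let coord k := trit_of (v (inord k) 0) in
  Point (coord 0) (coord 1) (coord 2) (coord 3).

Lemma vecK : cancel vec point_of.
Proof. by case=> a b c d; rewrite /point_of !mxE !inordK //= !trit_valK. Qed.

Lemma point_ofK : cancel point_of vec.
Proof.
move=> v; apply/colP => i; rewrite mxE -[i in RHS]inord_val.
by case: i => [[|[|[|[|n]]]] lt_i] //=; rewrite trit_ofK.
Qed.

HB.instance Definition _ := CanHasChoice vecK.

Definition point_add (x y : point) : point :=
  let: Point a b c d := x in let: Point a' b' c' d' := y in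
  Point (trit_add a a') (trit_add b b') (trit_add c c') (trit_add d d').

Definition point_opp (x : point) : point :=
  let: Point a b c d := x in Point (trit_opp a) (trit_opp b) (trit_opp c) (trit_opp d).

Definition point0 : point := Point T0 T0 T0 T0.

Lemma vec_add (x y : point) : vec (point_add x y) = vec x + vec y.
Proof.
apply/colP => i; rewrite !mxE; case: x y i => a b c d [a' b' c' d'].
by case=> [[|[|[|[|n]]]] lt_i]; rewrite //= trit_valD.
Qed.

Lemma vec_opp (x : point) : vec (point_opp x) = - vec x.
Proof.
apply/colP => i; rewrite !mxE; case: x i => a b c d.
by case=> [[|[|[|[|n]]]] lt_i]; rewrite //= trit_valN.
Qed.

Lemma vec_point0 : vec point0 = 0.
Proof. by apply/colP => -[[|[|[|[|n]]]] lt_i]; rewrite !mxE. Qed.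

Lemma point_addA : associative point_add.
Proof. by move=> x y z; apply: (can_inj vecK); rewrite !vec_add addrA. Qed.

Lemma point_addC : commutative point_add.
Proof. by move=> x y; apply: (can_inj vecK); rewrite !vec_add addrC. Qed.

Lemma point_add0 : left_id point0 point_add.
Proof. by move=> x; apply: (can_inj vecK); rewrite vec_add vec_point0 add0r. Qed.

Lemma point_addN : left_inverse point0 point_opp point_add.
Proof.
by move=> x; apply: (can_inj vecK); rewrite vec_add vec_opp vec_point0 addNr.
Qed.

HB.instance Definition _ :=
  GRing.isZmodule.Build point point_addA point_addC point_add0 point_addN.

Lemma vec_is_zmod_morphism : zmod_morphism vec.
Proof. by move=> x y; rewrite -vec_opp -vec_add. Qed.

HB.instance Definition _ :=
  GRing.isZmodMorphism.Build point AG43 vec vec_is_zmod_morphism.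

Lemma point_ofN (v : AG43) : point_of (- v) = - point_of v.
Proof. by apply: (can_inj vecK); rewrite raddfN /= !point_ofK. Qed.

Lemma point_ofD (v w : AG43) : point_of (v + w) = point_of v + point_of w.
Proof. by apply: (can_inj vecK); rewrite raddfD /= !point_ofK. Qed.

Lemma point_of_eq0 (v : AG43) : (point_of v == 0) = (v == 0).
Proof. by rewrite -(can_eq vecK) point_ofK raddf0. Qed.

(** * Projective points, cones and ovoids *)

Definition points : seq point :=
  [seq f d | f <- [seq f c | f <- [seq Point a b | a <- trits, b <- trits],
                             c <- trits], d <- trits].

(* Of the two vectors x and -x spanning a point of PG(3,3), the one whose first
   nonzero coordinate is 1. *)
Definition normalize (x : point) : point :=
  let: Point a b c d := x in
  let lead := match a, b, c, d with
    | T0, T0, T0, t | T0, T0, t, _ | T0, t, _, _ | t, _, _, _ => t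
    end in
  if lead is T2 then - x else x.

Definition proj_points : seq point := [seq x <- points | (x != 0) && (normalize x == x)].

Arguments points : simpl never.
Arguments proj_points : simpl never.

Lemma mem_points (x : point) : x \in points.
Proof. by case: x => -[] [] [] []. Qed.

Lemma mem_proj_points (x : point) : (x \in proj_points) = (x != 0) && (normalize x == x).
Proof. by rewrite mem_filter mem_points andbT. Qed.

Lemma proj_points_uniq : uniq proj_points.
Proof. by vm_compute. Qed.

Lemma normalize_id (x : point) : x \in proj_points -> normalize x = x.
Proof. by rewrite mem_proj_points => /andP[_ /eqP]. Qed.

Lemma normalize_cases (x : point) : normalize x = x \/ normalize x = - x.
Proof. by case: x => [] [] [] [] []; first [by left | by right]. Qed.

Lemma normalizeN (x : point) : normalize (- x) = normalize x.
Proof. by case: x => [] [] [] [] []. Qed.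

Lemma normalize_proj_points (x : point) : (normalize x \in proj_points) = (x != 0).
Proof. by rewrite mem_proj_points; case: x => [] [] [] [] []. Qed.

Lemma opp_proj_points (x : point) : x \in proj_points -> - x \notin proj_points.
Proof. by rewrite !mem_proj_points; case: x => [] [] [] [] []. Qed.

Lemma mem_normalize (l : seq point) (x : point) :
  {subset l <= proj_points} -> (normalize x \in l) = (x \in l) || (- x \in l).
Proof.
move=> l_proj; apply/idP/orP => [|[] xl].
- by case: (normalize_cases x) => -> xl; [left | right].
- by rewrite normalize_id ?l_proj.
by rewrite -normalizeN normalize_id ?l_proj.
Qed.

Lemma normalize_inj (x y : point) : normalize x = normalize y -> x = y \/ x = - y.
Proof.
case: (normalize_cases x) => ->; case: (normalize_cases y) => -> xy;
  [by left | by right | by right; rewrite -xy opprK | by left; apply: oppr_inj].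
Qed.

Lemma normalizeD (x y : point) :
  normalize (x + y) \in [:: normalize (normalize x + normalize y);
                            normalize (normalize x - normalize y)].
Proof.
rewrite !inE; case: (normalize_cases x) => ->; case: (normalize_cases y) => ->;
  by rewrite ?opprK -?(normalizeN (x + y)) ?opprD ?eqxx ?orbT.
Qed.

Definition cone (l : seq point) : {set AG43} := [set v | normalize (point_of v) \in l].

Definition rays (S : {set AG43}) : seq point := [seq x <- proj_points | vec x \in S].

Lemma coneN (l : seq point) : {in cone l, forall v, - v \in cone l}.
Proof. by move=> v; rewrite !inE point_ofN normalizeN. Qed.

Lemma vec_cone (l : seq point) (x : point) :
  x \in proj_points -> (vec x \in cone l) = (x \in l).
Proof. by move=> x_proj; rewrite inE vecK normalize_id. Qed.

Lemma mem_rays (S : {set AG43}) (x : point) :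
  (x \in rays S) = (x \in proj_points) && (vec x \in S).
Proof. by rewrite mem_filter andbC. Qed.

Lemma cone0 (l : seq point) : {subset l <= proj_points} -> 0 \notin cone l.
Proof.
move=> l_proj; rewrite inE; apply/negP => /l_proj.
by rewrite normalize_proj_points point_of_eq0 eqxx.
Qed.

Lemma cone_proj_points : cone proj_points = ~: [set 0].
Proof.
apply/setP => v.
by rewrite in_setC in_set1 in_set normalize_proj_points point_of_eq0.
Qed.

Lemma rays_cone (l : seq point) : subseq l proj_points -> rays (cone l) = l.
Proof.
move=> /(subseq_uniqP proj_points_uniq) l_eq; rewrite [RHS]l_eq.
by apply: eq_in_filter => x x_proj; rewrite vec_cone.
Qed.

Lemma mem_rays_normalize (S : {set AG43}) (v : AG43) : oppr_closed S -> 0 \notin S ->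
  (normalize (point_of v) \in rays S) = (v \in S).
Proof.
move=> S_opp S0; rewrite mem_rays normalize_proj_points point_of_eq0.
have -> : (vec (normalize (point_of v)) \in S) = (v \in S).
  case: (normalize_cases (point_of v)) => ->; rewrite ?raddfN /= point_ofK //.
  by apply/idP/idP => /S_opp; rewrite ?opprK.
case: (boolP (v \in S)) => [vS|]; rewrite ?andbF // andbT.
by apply: contraNneq S0 => <-.
Qed.

Lemma cone_rays (S : {set AG43}) : oppr_closed S -> 0 \notin S -> cone (rays S) = S.
Proof. by move=> S_opp S0; apply/setP => v; rewrite inE mem_rays_normalize. Qed.

Lemma card_cone (l : seq point) :
  uniq l -> {subset l <= proj_points} -> #|cone l| = (size l).*2.
Proof.
move=> l_uniq l_proj; pose l' := l ++ map -%R l.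
have l'_uniq : uniq l'.
  rewrite cat_uniq map_inj_uniq ?l_uniq ?andbT //; last exact: oppr_inj.
  apply/hasPn => _ /mapP[x xl ->]; apply/negP => /l_proj.
  exact/negP/opp_proj_points/l_proj.
have -> : cone l = [set v in map vec l'].
  apply/setP => v; rewrite !inE mem_normalize //.
  rewrite -{3}[v]point_ofK (mem_map (can_inj vecK)).
  by rewrite mem_cat -(mem_map oppr_inj l (- _)) opprK.
rewrite cardsE; have /card_uniqP-> : uniq (map vec l').
  by rewrite (map_inj_uniq (can_inj vecK)).
by rewrite size_map size_cat size_map addnn.
Qed.

Definition proj_cap (l : seq point) : bool :=
  all (fun x => all (fun y => (x == y) ||
    ((normalize (x + y) \notin l) && (normalize (x - y) \notin l))) l) l.

Lemma proj_capP (l : seq point) :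
  reflect {in l &, forall x y, x != y ->
             normalize (x + y) \notin l /\ normalize (x - y) \notin l}
          (proj_cap l).
Proof.
apply: (iffP allP) => [cap_l x y xl yl xy | cap_l x xl].
  by have /allP/(_ _ yl) := cap_l x xl; rewrite (negPf xy) => /andP.
by apply/allP => y yl; case: eqVneq => //= xy; apply/andP/cap_l.
Qed.

Lemma proj_cap_sub (l l' : seq point) : {subset l' <= l} -> proj_cap l -> proj_cap l'.
Proof.
move=> l'_l /proj_capP cap_l; apply/proj_capP => x y /l'_l xl /l'_l yl xy.
have [sumNl diffNl] := cap_l x y xl yl xy.
by split; [apply: contra sumNl | apply: contra diffNl]; apply: l'_l.
Qed.

Lemma is_lineP (L : {set AG43}) :
  reflect (exists x y z,
             [/\ x != y, y != z, x != z, x + y + z = 0 & L = x |: [set y; z]])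
          (is_line L).
Proof.
have sum3 (x y z : AG43) : x != y -> y != z -> x != z ->
    \sum_(v in x |: [set y; z]) v = x + y + z.
  by move=> xy yz xz; rewrite !big_setU1 ?inE ?negb_or ?xy //= big_set1 addrA.
apply: (iffP andP) => [[/cards3P] | ] [x [y [z [xy yz xz]]]].
  by move=> ->; rewrite sum3 // => /eqP sum0; exists x, y, z.
by move=> sum0 ->; split; [apply/cards3P; exists x, y, z | rewrite sum3 // sum0].
Qed.

Lemma is_capP (S : {set AG43}) : reflect (capset S) (is_cap S).
Proof.
apply: (iffP forall_inP) => [cap_S x y z xS yS zS xy yz xz | cap_S L].
  apply/negP => /eqP sum0; have : is_line (x |: [set y; z]).
    by apply/is_lineP; exists x, y, z.
  by move=> /cap_S /negP[]; rewrite !subUset !sub1set xS yS zS.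
move=> /is_lineP[x [y [z [xy yz xz sum0 ->]]]].
rewrite !subUset !sub1set; apply/negP => /and3P[xS yS zS].
by have := cap_S x y z xS yS zS xy yz xz; rewrite sum0 eqxx.
Qed.

Lemma capset_proj_cap (l : seq point) :
  {subset l <= proj_points} -> capset (cone l) -> proj_cap l.
Proof.
move=> l_proj cap_l; have third x y : normalize x \in l -> normalize y \in l -> x != y ->
    normalize (x + y) \notin l.
  move=> xl yl xy; apply/negP => xyl; have vxy : vec x != vec y by rewrite (can_eq vecK).
  have in_cone z : normalize z \in l -> vec z \in cone l by rewrite inE vecK.
  have := cap_l (vec x) (vec y) (vec (- (x + y))) (in_cone _ xl) (in_cone _ yl).
  rewrite in_cone ?normalizeN // raddfN raddfD /= subrr eqxx eq_third_F3 vxy.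
  by rewrite [vec x + _]addrC eq_third_F3 eq_sym vxy => /(_ isT isT isT isT).
apply/proj_capP => x y xl yl xy.
split; apply: third; rewrite ?normalizeN ?normalize_id ?l_proj //.
by apply: contraTneq (l_proj _ xl) => ->; apply/opp_proj_points/l_proj.
Qed.

Lemma proj_cap_capset (l : seq point) :
  {subset l <= proj_points} -> proj_cap l -> capset (cone l).
Proof.
move=> l_proj /proj_capP cap_l v w t; rewrite !inE => vl wl tl vw _ _.
apply/negP; rewrite addr_eq0 => /eqP t_eq.
have {}tl : normalize (point_of v + point_of w) \in l.
  by rewrite -point_ofD t_eq point_ofN normalizeN.
have [/normalize_inj[/(can_inj point_ofK)/eqP|vNw] | nvw] :=
    eqVneq (normalize (point_of v)) (normalize (point_of w)).
- by rewrite (negPf vw).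
- by have := l_proj _ tl; rewrite normalize_proj_points vNw addNr eqxx.
have [sumNl diffNl] := cap_l _ _ vl wl nvw.
by have := normalizeD (point_of v) (point_of w); rewrite !inE => /orP[] /eqP E;
   rewrite -E tl in sumNl diffNl.
Qed.

Lemma is_cap_cone (l : seq point) :
  {subset l <= proj_points} -> is_cap (cone l) = proj_cap l.
Proof.
move=> l_proj; apply/is_capP/idP; [exact: capset_proj_cap | exact: proj_cap_capset].
Qed.

Definition ovoid_in (R b : seq point) : bool :=
  [&& subseq b R, size b == 10 & proj_cap b].

Local Notation is_ovoid := (ovoid_in proj_points).

Lemma ovoid_in_trans (R b : seq point) :
  subseq R proj_points -> ovoid_in R b -> is_ovoid b.
Proof.
by move=> R_proj /and3P[/subseq_trans/(_ R_proj) b_proj b_size b_cap]; apply/and3P.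
Qed.

Lemma ovoid_sub (R b : seq point) : ovoid_in R b -> {subset b <= R}.
Proof. by move=> /and3P[/mem_subseq]. Qed.

Lemma is_cap_ovoid (b : seq point) : is_ovoid b -> is_cap (cone b).
Proof.
by move=> ov_b; have /and3P[_ _] := ov_b; rewrite is_cap_cone //; apply: ovoid_sub.
Qed.

Lemma card_ovoid (b : seq point) : is_ovoid b -> #|cone b| = 20%N.
Proof.
move=> ov_b; have /and3P[b_proj /eqP b_size _] := ov_b.
by rewrite card_cone ?b_size ?(subseq_uniq b_proj proj_points_uniq) //; apply: ovoid_sub.
Qed.

(** * Searching for ovoids *)

Definition secants (x : point) (chosen : seq point) : seq point :=
  flatten [seq [:: normalize (x + y); normalize (x - y)] | y <- chosen].

Lemma secants_proj_cap (b chosen : seq point) (x : point) :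
    proj_cap b -> {subset chosen <= b} -> x \in b -> x \notin chosen ->
  {in b, forall z, z \notin secants x chosen}.
Proof.
move=> /proj_capP cap_b chosen_b xb x_new z zb; apply/flatten_mapP => -[y yc].
have [|sumNb diffNb] := cap_b x y xb (chosen_b _ yc).
  by apply: contraNneq x_new => ->.
by rewrite !inE => /orP[] /eqP z_eq; move: zb; rewrite z_eq; apply/negP.
Qed.

(* The sets of k candidates that extend the chosen points to a cap of PG(3,3),
   provided that no candidate lies on a secant of the chosen points. *)
Fixpoint cap_search (k : nat) : seq point -> seq point -> seq (seq point) :=
  if k is k'.+1 then
    fix choose (chosen candidates : seq point) {struct candidates} :=
      if candidates is x :: others then
        if (size others < k')%N then [::] else
        [seq x :: l | l <- cap_search k' (x :: chosen)
                             [seq z <- others | z \notin secants x chosen]] ++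
        choose chosen others
      else [::]
  else fun _ _ => [:: [::]].

Lemma cap_search_complete (b : seq point) (k : nat) (chosen candidates : seq point) :
    proj_cap b -> {subset chosen <= b} -> uniq (chosen ++ candidates) ->
    count (mem b) candidates = k ->
  [seq z <- candidates | z \in b] \in cap_search k chosen candidates.
Proof.
move=> cap_b; elim: k chosen candidates => [|k IHk] chosen candidates chosen_b.
  by rewrite inE -size_eq0 size_filter => _ ->.
elim: candidates => [|x others IHo] //= uniq_cand.
have {}uniq_cand : uniq (x :: chosen ++ others) by rewrite -(uniq_catCA _ [:: x]).
have /andP[/[!mem_cat]/norP[x_new _] uniq_others] := uniq_cand.
case: ifP => xb count_k; last first.
  case: ifP => [lt_k|_]; last by rewrite mem_cat IHo ?orbT.
  by have := count_size (mem b) others; rewrite -[count _ _]add0n count_k leqNgt ltnW.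
have {}count_k := succn_inj count_k.
rewrite ltnNge -[in (k <= _)%N]count_k count_size /= mem_cat; apply/orP; left.
have others_b : [seq z <- others | z \in b] =
    [seq z <- [seq z <- others | z \notin secants x chosen] | z \in b].
  rewrite -filter_predI; apply: eq_filter => z /=.
  by case: (boolP (z \in b)) => //= /(secants_proj_cap cap_b chosen_b xb x_new) ->.
rewrite others_b; apply: map_f; apply: IHk.
- by move=> z; rewrite inE => /orP[/eqP->|/chosen_b].
- by apply: subseq_uniq uniq_cand; rewrite -cat_cons cat_subseq ?filter_subseq.
by rewrite -count_k -!size_filter others_b.
Qed.

Definition ovoids_at_head (R : seq point) : seq (seq point) :=
  if R is q :: R' then
    [seq b <- [seq q :: l | l <- cap_search 9 [:: q] R'] | ovoid_in R b]
  else [::].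

Lemma mem_ovoids_at_head (R b : seq point) : uniq R ->
  (b \in ovoids_at_head R) = ovoid_in R b && (head 0 R \in b).
Proof.
case: R => [_|q R uniq_R].
  by rewrite /ovoid_in subseq0; case: b => // x b; rewrite andbF.
apply/idP/andP => [|[ov_b qb]].
  by rewrite mem_filter => /andP[ov_b /mapP[l _ b_eq]]; rewrite ov_b b_eq mem_head.
have /and3P[b_R /eqP b_size b_cap] := ov_b.
have b_eq : b = q :: [seq z <- R | z \in b].
  by rewrite [LHS](subseq_uniqP uniq_R b_R) /= ifT.
rewrite mem_filter ov_b {1}b_eq; apply: map_f; apply: cap_search_complete => //.
  by move=> x; rewrite inE => /eqP->.
by move: b_size; rewrite {1}b_eq /= size_filter => /succn_inj.
Qed.

Definition without (R b : seq point) : seq point := [seq x <- R | x \notin b].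

Fixpoint ovoid_partitions (n : nat) (R : seq point) : seq (seq (seq point)) :=
  if n is n'.+1 then
    flatten [seq [seq b :: bs | bs <- ovoid_partitions n' (without R b)]
            | b <- ovoids_at_head R]
  else if R is [::] then [:: [::]] else [::].

(** * Symmetries and tables *)

(* The columns of a 4 x 4 matrix. *)
Definition mat : Type := (point * point * point * point)%type.

Definition point_scale (t : trit) (x : point) : point :=
  match t with T0 => 0 | T1 => x | T2 => - x end.

Definition mat_apply (m : mat) (x : point) : point :=
  let: (c1, c2, c3, c4) := m in let: Point a b c d := x in
  point_scale a c1 + point_scale b c2 + point_scale c c3 + point_scale d c4.

Definition mat_mul (m m' : mat) : mat :=
  let: (c1, c2, c3, c4) := m' in
  (mat_apply m c1, mat_apply m c2, mat_apply m c3, mat_apply m c4).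

Definition mat_inj (m : mat) : bool := all (fun x => mat_apply m x != 0) proj_points.

(* Under call-by-value evaluation [find] stops at the first witness, [has] does
   not. *)
Definition lazy_has (T : Type) (p : pred T) (s : seq T) : bool := (find p s < size s)%N.

Definition lazy_all (T : Type) (p : pred T) (s : seq T) : bool := ~~ lazy_has (predC p) s.

Lemma lazy_hasE (T : Type) (p : pred T) (s : seq T) : lazy_has p s = has p s.
Proof. by rewrite has_find. Qed.

Lemma lazy_allE (T : Type) (p : pred T) (s : seq T) : lazy_all p s = all p s.
Proof. by rewrite /lazy_all lazy_hasE has_predC negbK. Qed.

Definition maps_into (m : mat) (b c : seq point) : bool :=
  lazy_all (fun x => normalize (mat_apply m x) \in c) b.

Definition maps_blocks (m : mat) (bs cs : seq (seq point)) : bool :=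
  lazy_all (fun b => lazy_has (maps_into m b) cs) bs.

Definition basis : seq point :=
  [:: Point T1 T0 T0 T0; Point T0 T1 T0 T0; Point T0 T0 T1 T0; Point T0 T0 T0 T1].

Definition signed_permutations : seq mat :=
  let signed := basis ++ map -%R basis in
  [seq m <- [seq (f, x) | f <- [seq (f, x) | f <- [seq (x, y) | x <- basis, y <- signed],
     x <- signed], x <- signed] | mat_inj m].

Definition beyond_basis : seq point :=
  [seq z <- proj_points | (z \notin basis) && proj_cap (z :: basis)].

(* The coefficients are those of aa, ab, ac, ad, bb, bc, bd, cc, cd, dd. *)
Definition quadric (coefs : seq trit) : seq point :=
  let value x := let: Point a b c d := x in
    foldr trit_add T0 [seq trit_mul p.1 (trit_mul p.2.1 p.2.2) | p <- zip coefs
      [:: (a, a); (a, b); (a, c); (a, d); (b, b); (b, c); (b, d); (c, c);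
          (c, d); (d, d)]] in
  [seq x <- proj_points | value x == T0].

Definition std_ovoid : seq point := quadric [:: T0; T1; T1; T1; T0; T1; T1; T0; T2; T0].

(* Found, like [double_completion], by computer search. *)
Definition single_completion : seq (seq point) :=
  [:: quadric [:: T1; T2; T1; T2; T2; T1; T2; T1; T0; T2];
      quadric [:: T1; T1; T0; T1; T2; T0; T1; T1; T1; T2];
      quadric [:: T1; T0; T2; T0; T2; T2; T0; T1; T2; T2]].

Definition double_completion : seq (seq point) :=
  [:: quadric [:: T1; T0; T2; T0; T2; T0; T0; T2; T0; T1];
      quadric [:: T1; T0; T0; T0; T1; T0; T1; T2; T0; T2];
      quadric [:: T1; T0; T1; T2; T1; T2; T1; T2; T0; T2]].

(* Products g^i h^j g^k of two symmetries of [std_ovoid], of orders 10 and 6 in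
   PGL(4,3); they already act transitively on the two kinds of partitions
   containing [std_ovoid]. *)
Definition std_symmetries : seq mat :=
  let g := (Point T0 T0 T0 T1, Point T2 T2 T2 T0,
            Point T2 T0 T0 T0, Point T0 T2 T0 T0) in
  let h := (Point T1 T2 T1 T2, Point T0 T0 T0 T2,
            Point T0 T0 T1 T0, Point T2 T0 T0 T0) in
  let powers m (n : nat) := traject (mat_mul m) m n in
  let products := [seq mat_mul x y | x <- powers g 10%N, y <- powers h 6%N] in
  [seq m <- [seq mat_mul f x | f <- products, x <- powers g 10%N] | mat_inj m].

Definition pair_completions (b c : seq point) : seq (seq (seq point)) :=
  ovoid_partitions 2 (without (without proj_points b) c).

(* The first blocks tell the completions apart, so that none is counted twice. *)
Definition completable_ovoids (k : nat) (b c : seq point) : bool :=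
  let completions := pair_completions b c in
  (size completions == k) && uniq (map (head [::]) completions).

(* The counts of the pairs at block 0, namely k, 6 and 6, determine k. *)
Definition split_type (k : nat) (bs : seq (seq point)) : bool :=
  let b i := nth [::] bs i in
  [&& size bs == 4%N, completable_ovoids k (b 0%N) (b 1%N),
      completable_ovoids k (b 2%N) (b 3%N), completable_ovoids 6 (b 0%N) (b 2%N) &
      completable_ovoids 6 (b 0%N) (b 3%N)].

Arguments without : simpl never.
Arguments std_ovoid : simpl never.
Arguments single_completion : simpl never.
Arguments double_completion : simpl never.

Lemma std_ovoidP : is_ovoid std_ovoid. Proof. by vm_compute. Qed.

Lemma basis_caps_table :
  all (fun l => has (fun m => maps_into m std_ovoid (basis ++ l)) signed_permutations)
    (cap_search 6 basis beyond_basis).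
Proof. by vm_compute. Qed.

Lemma std_completions_table :
  let completions := ovoid_partitions 3 (without proj_points std_ovoid) in
  [&& single_completion \in completions, double_completion \in completions &
      all (fun bs => lazy_has (fun m => lazy_has (maps_blocks m (std_ovoid :: bs))
            [:: std_ovoid :: single_completion; std_ovoid :: double_completion])
          std_symmetries) completions].
Proof. by vm_compute. Qed.

Lemma split_type_table :
  split_type 1 (std_ovoid :: single_completion) &&
  split_type 2 (std_ovoid :: double_completion).
Proof. by vm_compute. Qed.

(** * Maximal caps and their anchors *)

Lemma is_maxcapE (S : {set AG43}) : is_maxcap S = is_cap S && (#|S| == 20%N).
Proof.
have cap_le T : is_cap T -> (#|T| <= 20)%N by move/is_capP/card_capset_AG43.
apply/andP/andP => -[cap_S]; last first.
  by move=> /eqP card_S; split=> //; apply/forall_inP => T /cap_le; rewrite card_S.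
move=> /forall_inP/(_ _ (is_cap_ovoid std_ovoidP)).
rewrite card_ovoid ?std_ovoidP // => le_S.
by split=> //; rewrite eqn_leq cap_le.
Qed.

Lemma card_maxcap (S : {set AG43}) : is_maxcap S -> #|S| = 20%N.
Proof. by rewrite is_maxcapE => /andP[_ /eqP]. Qed.

Lemma maxcap_neq_set1 (S : {set AG43}) (v : AG43) : is_maxcap S -> S != [set v].
Proof. by move/card_maxcap; apply: contra_eq_neq => ->; rewrite cards1. Qed.

Lemma anchor_pairs_stable (a : AG43) (S : {set AG43}) (Q : {set {set AG43}}) :
    a \notin S -> cover Q = S ->
    {in Q, forall p : {set AG43}, #|p| = 2%N /\ is_line (a |: p)} ->
  {in S, forall v, - (a + v) \in S}.
Proof.
move=> aS cover_Q lines_Q v; rewrite -cover_Q => /bigcupP[p pQ vp].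
apply/bigcupP; exists p => //.
have [/eqP/cards2P[u [w [uw p_eq]]] /andP[_ /eqP sum0]] := lines_Q p pQ.
have ap : a \notin p.
  by apply: contra aS => ap; rewrite -cover_Q; apply/bigcupP; exists p.
move: sum0; rewrite big_setU1 //= p_eq big_setU1 ?inE //= big_set1.
move: vp; rewrite p_eq !inE => /orP[] /eqP-> /eqP.
  by rewrite addrA addr_eq0 => /eqP->; rewrite opprK eqxx orbT.
by rewrite (addrC u) addrA addr_eq0 => /eqP->; rewrite opprK eqxx.
Qed.

Lemma is_anchorP (a : AG43) (S : {set AG43}) : #|S| = 20%N ->
  reflect (a \notin S /\ {in S, forall v, - (a + v) \in S}) (is_anchor a S).
Proof.
move=> card_S; apply: (iffP andP) => -[aS].
  move=> /existsP[Q /and3P[_ /forall_inP lines_Q /eqP cover_Q]]; split=> //.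
  by apply: anchor_pairs_stable aS cover_Q _ => p /lines_Q/andP[/eqP].
pose r (v : AG43) : AG43 := - (a + v) => r_stable.
have r_invol : involutive r by move=> v; rewrite /r opprD opprK addKr.
have neq_a v : v \in S -> a != v by apply: contraTneq => <-.
have r_free : {in S, forall v, r v != v}.
  by move=> v vS; rewrite eq_sym /r addrC eq_third_F3 eq_sym neq_a.
split=> //; apply/existsP; exists (orbit_pairs r S); apply/and3P; split.
- rewrite -(eqn_pmul2r (isT : 0 < 2)%N).
  by rewrite -(card_orbit_pairs r_invol r_stable r_free) card_S.
- apply/forall_inP => p pQ; rewrite (card_orbit_pair r_free pQ) /=.
  have /imsetP[v vS ->] := pQ; apply/is_lineP; exists a, v, (r v).
  by rewrite neq_a // neq_a ?r_stable // eq_sym r_free // subrr.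
by have /cover_partition -> := orbit_pairs_partition r_invol r_stable.
Qed.

(* Two distinct point reflections of S compose to a nontrivial translation,
   whose orbits are lines. *)
Lemma anchor_unique (a b : AG43) (S : {set AG43}) :
  is_maxcap S -> is_anchor a S -> is_anchor b S -> a = b.
Proof.
rewrite is_maxcapE => /andP[/is_capP cap_S /eqP card_S].
move=> /(is_anchorP _ card_S)[_ refl_a] /(is_anchorP _ card_S)[_ refl_b].
apply/eqP; rewrite -subr_eq0; apply/negPn/negP => d0; set d := a - b in d0.
have transl v : v \in S -> v + d \in S.
  by move=> /refl_a/refl_b; rewrite opprD opprK addrA (addrC (- b)) addrC.
have /card_gt0P[v vS] : (0 < #|S|)%N by rewrite card_S.
have neq_d w : w != w + d by rewrite -subr_eq0 opprD addNKr oppr_eq0.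
have := cap_S _ _ _ vS (transl _ vS) (transl _ (transl _ vS)) (neq_d _) (neq_d _).
have -> : v + (v + d) + (v + d + d) = (v + v + v) + (d + d + d).
  by apply/colP => i; rewrite !mxE; ring.
rewrite !addr3_F3 addr0 eqxx => not_line; suff /not_line : v != v + d + d by [].
by rewrite -addrA addrr_F3 eq_sym subr_eq addrC eq_sym -subr_eq0 addrK.
Qed.

Definition centered_cap (S : {set AG43}) : bool := is_maxcap S && is_anchor 0 S.

Lemma centered_cap_ovoid (b : seq point) : is_ovoid b -> centered_cap (cone b).
Proof.
move=> ov_b; apply/andP; split; first by rewrite is_maxcapE is_cap_ovoid ?card_ovoid.
apply/is_anchorP; first exact: card_ovoid.
by split=> [|v /coneN]; rewrite ?add0r //; apply/cone0/ovoid_sub.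
Qed.

Lemma centered_cap_rays (S : {set AG43}) :
  centered_cap S -> is_ovoid (rays S) /\ cone (rays S) = S.
Proof.
case/andP => max_S; have card_S := card_maxcap max_S.
move: max_S; rewrite is_maxcapE => /andP[cap_S _] /(is_anchorP _ card_S)[S0 S_refl].
have S_opp : {in S, forall v, - v \in S} by move=> v /S_refl; rewrite add0r.
have rays_S := cone_rays S_opp S0; split=> //.
have rays_proj : subseq (rays S) proj_points by apply: filter_subseq.
apply/and3P; split=> //; last by rewrite -is_cap_cone ?rays_S //; apply: mem_subseq.
have := card_cone (subseq_uniq rays_proj proj_points_uniq) (mem_subseq rays_proj).
by rewrite rays_S card_S => size_S; rewrite -(inj_eq double_inj) -size_S.
Qed.

(** * Invariance under Aff(4,3) *)

Implicit Types (s : {perm AG43}) (S X Y : {set AG43}) (P : {set {set AG43}}).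

Lemma Aff43P s :
  reflect (exists2 A : 'M['F_3]_4, A \in unitmx &
             exists b, forall v, s v = A *m v + b)
          (s \in Aff43).
Proof.
rewrite inE; apply: (iffP existsP) => [[A /existsP[b /andP[uA /forallP s_eq]]]|].
  by exists A => //; exists b => v; apply/eqP.
move=> [A uA [b s_eq]]; exists A; apply/existsP; exists b.
by rewrite uA; apply/forallP => v; rewrite s_eq.
Qed.

Lemma affine_perm (A : 'M['F_3]_4) (b : AG43) : A \in unitmx ->
  exists2 s, s \in Aff43 & forall v, s v = A *m v + b.
Proof.
move=> uA; have aff_inj : injective (fun v : AG43 => A *m v + b).
  by move=> u v /addIr /(can_inj (mulKmx uA)).
exists (perm aff_inj) => [|v]; last by rewrite permE.
by apply/Aff43P; exists A => //; exists b => v; rewrite permE.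
Qed.

Section AffineInvariance.

Variable s : {perm AG43}.
Hypothesis s_aff : s \in Aff43.

Lemma Aff43V : s^-1%g \in Aff43.
Proof. by rewrite (groupV Aff43_group). Qed.

Lemma aff_sum3 (x y z : AG43) : (s x + s y + s z == 0) = (x + y + z == 0).
Proof.
have [A uA [b s_eq]] := Aff43P s s_aff.
have -> : s x + s y + s z = A *m (x + y + z) + (b + b + b).
  by rewrite !s_eq !mulmxDr; apply/colP => i; rewrite !mxE; ring.
by rewrite addr3_F3 addr0 -[0 in LHS](mulmx0 _ A) (can_eq (mulKmx uA)).
Qed.

Lemma is_maxcap_aff S : is_maxcap S -> is_maxcap (s @: S).
Proof.
rewrite !is_maxcapE => /andP[/is_capP cap_S card_S].
rewrite card_imset ?card_S ?andbT; last exact: perm_inj.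
apply/is_capP; apply: capset_imset cap_S => x y z _ _ _ /eqP.
by rewrite aff_sum3 => /eqP.
Qed.

Lemma is_anchor_aff a S : is_maxcap S -> is_anchor a S -> is_anchor (s a) (s @: S).
Proof.
move=> max_S /(is_anchorP _ (card_maxcap max_S))[aS S_refl].
apply/is_anchorP; first exact/card_maxcap/is_maxcap_aff.
split=> [|_ /imsetP[x xS ->]]; first by rewrite (mem_imset _ _ (@perm_inj _ s)).
apply/imsetP; exists (- (a + x)); first exact: S_refl.
by apply/eqP; rewrite eq_sym -addr_eq0 addrC aff_sum3 subrr.
Qed.

Lemma mem_set_act P X : (s @: X \in ('P^*^*)%act P s) = (X \in P).
Proof. exact/mem_imset/imset_inj/perm_inj. Qed.

Lemma is_cap_partition_aff a P :
  is_cap_partition a P -> is_cap_partition (s a) (('P^*^*)%act P s).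
Proof.
move=> /and4P[part_P aP /eqP card_P /forall_inP caps_P].
have actD1 : ('P^*^*)%act P s :\ [set s a] = ('P^*^*)%act (P :\ [set a]) s.
  have := imset_setD1 P [set a] (imset_inj (@perm_inj _ s)).
  by rewrite /= imset_set1.
apply/and4P; split.
- have <- : s @: [set: AG43] = [set: AG43].
    apply/setP => v; rewrite inE; apply/imsetP.
    by exists (s^-1%g v); rewrite ?inE ?permKV.
  by rewrite imset_partition //; apply: perm_inj.
- by rewrite -imset_set1 mem_set_act.
- by rewrite actD1 card_imset ?card_P //; apply/imset_inj/perm_inj.
rewrite actD1; apply/forall_inP => _ /imsetP[X /caps_P/andP[max_X anchor_X] ->].
by rewrite is_maxcap_aff // is_anchor_aff.
Qed.

Lemma cap_partitions_aff P :
  P \in cap_partitions -> ('P^*^*)%act P s \in cap_partitions.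
Proof.
rewrite !inE => /existsP[a part_P]; apply/existsP; exists (s a).
exact: is_cap_partition_aff.
Qed.

End AffineInvariance.

Lemma mem_cap_partitions_act s P : s \in Aff43 ->
  (('P^*^*)%act P s \in cap_partitions) = (P \in cap_partitions).
Proof.
move=> s_aff; apply/idP/idP; last exact: cap_partitions_aff.
by move/(cap_partitions_aff (Aff43V s_aff)); rewrite actK.
Qed.

Lemma card_partitions_containing_aff s X Y : s \in Aff43 ->
  #|[set P in cap_partitions | [set s @: X; s @: Y] \subset P]| =
  #|[set P in cap_partitions | [set X; Y] \subset P]|.
Proof.
move=> s_aff; rewrite -[RHS](card_imset _ (act_inj ('P^*^*)%act s)).
apply: eq_card => P; rewrite -[P](actKV ('P^*^*)%act s).
rewrite (mem_imset _ _ (act_inj ('P^*^*)%act s)).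
rewrite ![_ \in [set _ in _ | _]]in_set mem_cap_partitions_act //.
by rewrite !subUset !sub1set !mem_set_act.
Qed.

Lemma completable_pair_aff s k X Y :
  s \in Aff43 -> completable_pair k X Y -> completable_pair k (s @: X) (s @: Y).
Proof.
move=> s_aff /and5P[max_X max_Y disj_XY /existsP[a /andP[aX aY]] card_XY].
apply/and5P; split; rewrite ?is_maxcap_aff ?card_partitions_containing_aff //.
- by rewrite imset_disjoint //; apply: perm_inj.
by apply/existsP; exists (s a); rewrite !is_anchor_aff.
Qed.

Lemma splits_aff s k P :
  s \in Aff43 -> splits_into_completable_pairs k P ->
  splits_into_completable_pairs k (('P^*^*)%act P s).
Proof.
move=> s_aff [a [X [Y [Z [W [part_P P_eq XY ZW]]]]]].
exists (s a), (s @: X), (s @: Y), (s @: Z), (s @: W).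
split; [exact: is_cap_partition_aff | | exact: completable_pair_aff..].
by rewrite P_eq /= /setact !imsetU !imset_set1 /= /setact imset_set1.
Qed.

(** * Linear maps given by their columns *)

Definition mat_cols (m : mat) : seq point :=
  let: (c1, c2, c3, c4) := m in [:: c1; c2; c3; c4].

Definition mx_of (m : mat) : 'M['F_3]_4 :=
  \matrix_(i, j) vec (nth 0 (mat_cols m) j) i 0.

Lemma vec_scale (t : trit) (x : point) : vec (point_scale t x) = trit_val t *: vec x.
Proof. by case: t; rewrite /= ?raddf0 ?raddfN /= ?scale0r ?scale1r ?scaleN1r. Qed.

Lemma vec_mat_apply (m : mat) (x : point) : vec (mat_apply m x) = mx_of m *m vec x.
Proof.
case: m x => [[[c1 c2] c3] c4] [a b c d]; rewrite /= !raddfD /= !vec_scale.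
apply/colP => i; rewrite !mxE !big_ord_recl big_ord0 !mxE /=; ring.
Qed.

Lemma mat_applyN (m : mat) (x : point) : mat_apply m (- x) = - mat_apply m x.
Proof. by apply: (can_inj vecK); rewrite [RHS]raddfN /= !vec_mat_apply raddfN mulmxN. Qed.

Lemma unitmx_of_ker0 (F : fieldType) n (A : 'M[F]_n) :
  (forall v : 'cV_n, A *m v = 0 -> v = 0) -> A \in unitmx.
Proof.
move=> ker0; rewrite -unitmx_tr -row_free_unit; apply: inj_row_free => v v0.
apply: trmx_inj; rewrite [RHS]trmx0; apply: ker0.
by rewrite -[A]trmxK -trmx_mul v0 trmx0.
Qed.

Lemma mx_of_unit (m : mat) : mat_inj m -> mx_of m \in unitmx.
Proof.
move=> /allP m_inj; apply: unitmx_of_ker0 => v v0; apply/eqP/negPn/negP => vn0.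
have /m_inj/negP[] : normalize (point_of v) \in proj_points.
  by rewrite normalize_proj_points point_of_eq0.
rewrite -(can_eq vecK) vec_mat_apply raddf0.
by case: (normalize_cases (point_of v)) => ->;
   rewrite ?raddfN /= point_ofK ?mulmxN v0 ?oppr0.
Qed.

Lemma mat_affine (m : mat) : mat_inj m ->
  exists2 s, s \in Aff43 & forall x, s (vec x) = vec (mat_apply m x).
Proof.
move=> /mx_of_unit/(affine_perm 0)[s s_aff s_eq].
by exists s => // x; rewrite s_eq addr0 vec_mat_apply.
Qed.

Lemma maps_into_cone (m : mat) s (b c : seq point) :
    (forall x, s (vec x) = vec (mat_apply m x)) -> maps_into m b c ->
    (#|cone c| <= #|cone b|)%N ->
  s @: cone b = cone c.
Proof.
move=> s_eq; rewrite /maps_into lazy_allE => /allP m_bc le_card; apply/eqP.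
rewrite eqEcard card_imset ?le_card ?andbT; last exact: perm_inj.
apply/subsetP => _ /imsetP[v + ->]; rewrite !inE -{2}[v]point_ofK s_eq vecK => /m_bc.
by case: (normalize_cases (point_of v)) => -> //; rewrite mat_applyN normalizeN.
Qed.

(** * Transitivity on maximal caps *)

Lemma maxcap_spans S (u : 'rV_4) :
  is_maxcap S -> {in S, forall v, u *m v = 0} -> u = 0.
Proof.
rewrite is_maxcapE => /andP[/is_capP cap_S /eqP card_S] u_S.
apply/eqP/negPn/negP => u0; have := card_capset_slice 0 card_capset_space u0 cap_S.
suff -> : slice S u 0 = S by rewrite card_S.
apply/setP => v; rewrite inE; case: (boolP (v \in S)) => //= /u_S ->.
by rewrite mxE eqxx.
Qed.

Lemma maxcap_basis S : is_maxcap S ->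
  exists2 B : 'M['F_3]_4, B \in unitmx & forall i, col i B \in S.
Proof.
move=> max_S; pose M : 'M['F_3]_(#|S|, 4) := \matrix_(i < #|S|) (enum_val i)^T.
have full_M : row_full M.
  rewrite /row_full -mxrank_tr; apply: (inj_row_free (A := M^T)) => u uM0.
  apply: maxcap_spans max_S _ => v vS; apply: trmx_inj.
  rewrite trmx_mul; have <- : row (enum_rank_in vS v) M = v^T.
    by rewrite rowK enum_rankK_in.
  by rewrite -row_mul -[M]trmxK -trmx_mul uM0 !trmx0 row0.
exists (rowsub (fullrankfun full_M) M)^T => [|i].
  by rewrite unitmx_tr fullrowsub_unit.
have -> : col i (rowsub (fullrankfun full_M) M)^T = enum_val (fullrankfun full_M i).
  by apply/colP => k; rewrite !mxE.
exact: enum_valP.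
Qed.

Lemma basisP (x : point) : x \in basis -> exists i : 'I_4, vec x = delta_mx i 0.
Proof.
rewrite !inE => /or4P[] /eqP->; [exists 0 | exists 1 | exists 2%:R | exists 3%:R];
  by apply/colP => -[[|[|[|[|n]]]] lt_i]; rewrite !mxE.
Qed.

Lemma basis_proj_points : {subset basis <= proj_points}.
Proof. by apply/allP; vm_compute. Qed.

Lemma basis_completion S : centered_cap S -> {subset basis <= rays S} ->
  exists2 l, l \in cap_search 6 basis beyond_basis & S = cone (basis ++ l).
Proof.
move=> /centered_cap_rays[ov_S S_eq] basis_S.
have /and3P[rays_proj /eqP size_S cap_S] := ov_S.
pose l := [seq z <- beyond_basis | z \in rays S].
have mem_l : basis ++ l =i rays S.
  move=> z; rewrite mem_cat [z \in l]mem_filter [z \in beyond_basis]mem_filter.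
  case: (boolP (z \in basis)) => [/basis_S -> //|_] /=.
  apply: andb_idr => zS; rewrite (ovoid_sub ov_S zS) andbT.
  by apply: proj_cap_sub cap_S => x; rewrite inE => /orP[/eqP->|/basis_S].
have uniq_search : uniq (basis ++ beyond_basis) by vm_compute.
have uniq_l : uniq (basis ++ l).
  apply: (subseq_uniq _ uniq_search).
  exact: cat_subseq (subseq_refl _) (filter_subseq _ _).
exists l; last by rewrite -[LHS]S_eq; apply/setP => v; rewrite !in_set mem_l.
apply: (cap_search_complete cap_S basis_S uniq_search).
have /perm_size : perm_eq (basis ++ l) (rays S).
  exact: uniq_perm uniq_l (subseq_uniq rays_proj proj_points_uniq) mem_l.
by rewrite size_cat size_S size_filter => /(@addnI 4).
Qed.

Lemma basis_cap_orbit S : centered_cap S -> {subset basis <= rays S} ->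
  exists2 s, s \in Aff43 & s @: cone std_ovoid = S.
Proof.
move=> cent_S /(basis_completion cent_S)[l /(allP basis_caps_table)/hasP[m]].
rewrite mem_filter => /andP[/mat_affine[s s_aff s_eq] _] m_std S_eq.
exists s => //; rewrite S_eq; apply: maps_into_cone s_eq m_std _.
by rewrite -S_eq card_ovoid ?std_ovoidP //; have /andP[/card_maxcap-> _] := cent_S.
Qed.

Lemma mem_orbit_imset s S : s \in Aff43 -> s @: S \in orbit ('P^*)%act Aff43 S.
Proof. by move=> s_aff; apply/orbitP; exists s. Qed.

Lemma maxcap_orbit a S :
  is_maxcap S -> is_anchor a S -> cone std_ovoid \in orbit ('P^*)%act Aff43 S.
Proof.
move=> max_S anchor_S; have [t t_aff t_eq] := affine_perm (- a) (unitmx1 'F_3 4).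
have max_tS := is_maxcap_aff t_aff max_S.
have := is_anchor_aff t_aff max_S anchor_S; rewrite t_eq mul1mx subrr => anchor_tS.
have [B uB B_tS] := maxcap_basis max_tS.
have [u u_aff u_eq] := affine_perm 0 (etrans (unitmx_inv B) uB).
have cent_utS : centered_cap (u @: (t @: S)).
  apply/andP; split; first exact: is_maxcap_aff.
  by have := is_anchor_aff u_aff max_tS anchor_tS; rewrite u_eq mulmx0 addr0.
have [|s s_aff s_std] := basis_cap_orbit cent_utS.
  move=> x x_basis; rewrite mem_rays basis_proj_points //=.
  have [i ->] := basisP x_basis; apply/imsetP; exists (col i B) => //.
  by rewrite u_eq addr0 colE mulKmx.
have utS_std : cone std_ovoid \in orbit ('P^*)%act Aff43 (u @: (t @: S)).
  by rewrite (orbit_sym _ Aff43_group) -s_std mem_orbit_imset.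
apply: (orbit_trans (G := Aff43_group) utS_std).
apply: (orbit_trans (G := Aff43_group) (mem_orbit_imset _ u_aff)).
exact: mem_orbit_imset.
Qed.

(** * Partitions into ovoids *)

Definition cones (bs : seq (seq point)) : {set {set AG43}} := [set X in map cone bs].

Lemma cones_cons (b : seq point) (bs : seq (seq point)) :
  cones (b :: bs) = cone b |: cones bs.
Proof. by apply/setP => X; rewrite !inE. Qed.

Definition cone_partition (n : nat) (R : seq point) (Q : {set {set AG43}}) : bool :=
  [&& partition Q (cone R), #|Q| == n & [forall X in Q, centered_cap X]].

Lemma cone_nil : cone [::] = set0.
Proof. by apply/setP => v; rewrite !inE. Qed.

Lemma cone_without (R b : seq point) : cone (without R b) = cone R :\: cone b.
Proof. by apply/setP => v; rewrite in_setD !in_set mem_filter. Qed.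

Lemma cone_partition_block n R Q X :
  cone_partition n R Q -> X \in Q -> is_ovoid (rays X) /\ cone (rays X) = X.
Proof. by move=> /and3P[_ _ /forall_inP caps_Q] /caps_Q/centered_cap_rays. Qed.

Lemma cone_partitionD1 n R Q X :
  cone_partition n.+1 R Q -> X \in Q -> cone_partition n (without R (rays X)) (Q :\ X).
Proof.
move=> part_Q XQ; have [_ X_eq] := cone_partition_block part_Q XQ.
have /and3P[part card_Q /forall_inP caps_Q] := part_Q; apply/and3P; split.
- by rewrite cone_without X_eq partitionD1.
- by rewrite (cardsD1 X) XQ in card_Q.
by apply/forall_inP => Y /setD1P[_ /caps_Q].
Qed.

Lemma cone_partitionU1 n (R b : seq point) Q : {subset b <= R} -> is_ovoid b ->
  cone_partition n (without R b) Q -> cone_partition n.+1 R (cone b |: Q).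
Proof.
move=> b_R ov_b /and3P[part card_Q caps_Q].
have b_sub : cone b \subset cone R by apply/subsetP => v; rewrite !in_set => /b_R.
have b0 : cone b != set0 by rewrite -card_gt0 card_ovoid.
have disj : [disjoint cone b & cone (without R b)].
  by rewrite cone_without disjoint_sym disjoints_subset setDE subsetIr.
have bQ : cone b \notin Q.
  by apply: contraTN disj => bQ; rewrite -setI_eq0 (setIidPl (partitionS part bQ)).
apply/and3P; split; last 1 first.
- apply/forall_inP => X /setU1P[-> | /(forall_inP caps_Q)//].
  exact: centered_cap_ovoid.
- have := partitionU1 part b0 disj; rewrite cone_without.
  by rewrite -[X in X :|: _ :\: _](setIidPr b_sub) setID.
by rewrite cardsU1 bQ (eqP card_Q).
Qed.

Lemma is_cap_partition0 P :
  is_cap_partition 0 P = ([set 0] \in P) && cone_partition 4 proj_points (P :\ [set 0]).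
Proof.
rewrite /is_cap_partition /cone_partition cone_proj_points; apply/and4P/and4P => -[].
  move=> part P0 card_P caps_P; split=> //.
  by rewrite -setTD partitionD1.
move=> P0 part card_P caps_P; split=> //.
have := @partitionU1 _ _ _ [set 0] part; rewrite setD1K // setUCr; apply.
  by apply/set0Pn; exists 0; rewrite set11.
by rewrite disjoints_subset setCK.
Qed.

Lemma without_subseq (R b : seq point) : subseq (without R b) R.
Proof. exact: filter_subseq. Qed.

Definition ovoid_decomposition (n : nat) (R : seq point) (bs : seq (seq point)) : bool :=
  all is_ovoid bs && cone_partition n R (cones bs).

Lemma ovoid_decomposition_nil : ovoid_decomposition 0 [::] [::].
Proof.
have cones0 : cones [::] = set0 by apply/setP => X; rewrite !inE.
rewrite /ovoid_decomposition /cone_partition cones0 cone_nil partition_set0.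
by rewrite cards0 !eqxx /=; apply/forall_inP => X; rewrite inE.
Qed.

Lemma ovoid_decomposition_cons n (R b : seq point) (bs : seq (seq point)) :
    {subset b <= R} -> is_ovoid b -> ovoid_decomposition n (without R b) bs ->
  ovoid_decomposition n.+1 R (b :: bs).
Proof.
move=> b_R ov_b /andP[ov_bs part_bs]; apply/andP; split; first by rewrite /= ov_b.
by rewrite cones_cons; apply: cone_partitionU1.
Qed.

Lemma ovoid_partitions_sound n (R : seq point) (bs : seq (seq point)) :
  subseq R proj_points -> bs \in ovoid_partitions n R -> ovoid_decomposition n R bs.
Proof.
elim: n R bs => [|n IHn] R bs R_proj.
  by case: R {R_proj} => //=; rewrite inE => /eqP->; apply: ovoid_decomposition_nil.
case/flatten_mapP => b b_R /mapP[cs cs_part ->].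
have /andP[ov_b _] : ovoid_in R b && (head 0 R \in b).
  by rewrite -mem_ovoids_at_head // (subseq_uniq R_proj proj_points_uniq).
apply: ovoid_decomposition_cons; [exact: ovoid_sub ov_b | exact: ovoid_in_trans ov_b |].
exact/IHn/cs_part/(subseq_trans (without_subseq R b)).
Qed.

Lemma exists_head_block n (R : seq point) Q :
    subseq R proj_points -> cone_partition n.+1 R Q ->
  exists2 X, X \in Q & head 0 R \in rays X.
Proof.
case: R => [|q R] R_proj /and3P[part card_Q _].
  by move: part card_Q; rewrite cone_nil partition_set0 => /eqP->; rewrite cards0.
have q_proj : q \in proj_points by apply: (mem_subseq R_proj); rewrite mem_head.
have : vec q \in cone (q :: R) by rewrite vec_cone ?mem_head.
rewrite -(cover_partition part) => /bigcupP[X XQ qX]; exists X => //=.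
by rewrite mem_rays q_proj.
Qed.

Lemma rays_subseq (R : seq point) X :
  subseq R proj_points -> X \subset cone R -> subseq (rays X) R.
Proof.
move=> R_proj /subsetP X_R; have R_eq := subseq_uniqP proj_points_uniq R_proj.
have -> : rays X = [seq x <- R | vec x \in X]; last exact: filter_subseq.
rewrite [in RHS]R_eq -filter_predI; apply: eq_in_filter => x x_proj /=.
by apply/esym/andb_idr => /X_R; rewrite vec_cone.
Qed.

Lemma ovoid_partitions_complete n (R : seq point) Q :
    subseq R proj_points -> cone_partition n R Q ->
  exists2 bs, bs \in ovoid_partitions n R & Q = cones bs.
Proof.
elim: n R Q => [|n IHn] R Q R_proj part_Q.
  have /and3P[part /eqP/cards0_eq Q0 _] := part_Q.
  have -> : R = [::]; last by exists [::]; rewrite // Q0; apply/setP => X; rewrite !inE.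
  rewrite -(rays_cone R_proj) -(cover_partition part) Q0 /cover big_set0.
  by rewrite -[RHS](filter_pred0 proj_points); apply: eq_filter => x; rewrite in_set0.
have [X XQ qX] := exists_head_block R_proj part_Q.
have [ov_X X_eq] := cone_partition_block part_Q XQ.
have [|bs bs_part Q_eq] := IHn _ _ _ (cone_partitionD1 part_Q XQ).
  exact: subseq_trans (without_subseq _ _) R_proj.
exists (rays X :: bs); last by rewrite cones_cons X_eq -Q_eq setD1K.
apply/flatten_mapP; exists (rays X); last exact: map_f.
have [part _ _] := and3P part_Q; have [_ size_X cap_X] := and3P ov_X.
rewrite mem_ovoids_at_head ?qX ?(subseq_uniq R_proj proj_points_uniq) // andbT.
by rewrite /ovoid_in size_X cap_X rays_subseq ?(partitionS part).
Qed.

Local Notation full_decomposition := (ovoid_decomposition 4 proj_points).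

Definition partition_of (bs : seq (seq point)) : {set {set AG43}} := [set 0] |: cones bs.

Lemma mem_partition_of (bs : seq (seq point)) (b : seq point) :
  b \in bs -> cone b \in partition_of bs.
Proof. by move=> b_bs; rewrite !inE map_f ?orbT. Qed.

Lemma is_cap_partition_of (bs : seq (seq point)) :
  full_decomposition bs -> is_cap_partition 0 (partition_of bs).
Proof.
case/andP=> _ part_bs; rewrite is_cap_partition0 setU11 setU1K //.
have /and3P[_ _ /forall_inP caps_bs] := part_bs; apply/negP => /caps_bs/andP[max0 _].
by have := @maxcap_neq_set1 [set 0] 0 max0; rewrite eqxx.
Qed.

Lemma partition_of_cap_partitions (bs : seq (seq point)) :
  full_decomposition bs -> partition_of bs \in cap_partitions.
Proof.
by move=> dec_bs; rewrite inE; apply/existsP; exists 0; apply: is_cap_partition_of.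
Qed.

Lemma card_cap_partition a P : is_cap_partition a P -> #|P| = 5%N.
Proof. by move=> /and4P[_ aP /eqP card_P _]; rewrite (cardsD1 [set a]) aP card_P. Qed.

Lemma cap_partition_center P X :
  P \in cap_partitions -> X \in P -> centered_cap X -> is_cap_partition 0 P.
Proof.
rewrite inE => /existsP[a part_P] XP /andP[max_X anchor_X].
suff <- : a = 0 by [].
have /and4P[_ _ _ /forall_inP caps_P] := part_P.
have /caps_P/andP[_ anchor_a] : X \in P :\ [set a].
  by rewrite !inE XP maxcap_neq_set1.
exact: anchor_unique max_X anchor_a anchor_X.
Qed.

Lemma cap_partition_without P (b : seq point) :
    P \in cap_partitions -> is_ovoid b -> cone b \in P ->
  [set 0] \in P /\ cone_partition 3 (without proj_points b) (P :\ [set 0] :\ cone b).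
Proof.
move=> cap_P ov_b bP; have cent_b := centered_cap_ovoid ov_b.
have := cap_partition_center cap_P bP cent_b.
rewrite is_cap_partition0 => /andP[P0 part_P]; split=> //.
have /and3P[b_proj _ _] := ov_b; rewrite -{1}(rays_cone b_proj).
have /andP[max_b _] := cent_b.
by apply: cone_partitionD1; rewrite // !inE maxcap_neq_set1.
Qed.

Lemma cap_partition_completion P (b : seq point) :
    P \in cap_partitions -> is_ovoid b -> cone b \in P ->
  exists2 bs, bs \in ovoid_partitions 3 (without proj_points b) &
              P = partition_of (b :: bs).
Proof.
move=> cap_P ov_b bP; have [P0 part_b] := cap_partition_without cap_P ov_b bP.
have [bs bs_part bs_eq] := ovoid_partitions_complete (without_subseq _ _) part_b.
exists bs => //; rewrite /partition_of cones_cons -bs_eq !setD1K // !inE bP andbT.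
by have /andP[/maxcap_neq_set1->] := centered_cap_ovoid ov_b.
Qed.

Section PairCompletions.

Variables b c : seq point.
Hypotheses (b_ovoid : is_ovoid b) (c_ovoid : is_ovoid c).
Hypothesis disjoint_bc : [disjoint cone b & cone c].

Let R := without (without proj_points b) c.

Lemma subseq_without2 : subseq R proj_points.
Proof. exact: subseq_trans (without_subseq _ _) (without_subseq _ _). Qed.

Lemma pair_completion_decomposition bs :
  bs \in pair_completions b c -> full_decomposition [:: b, c & bs].
Proof.
move=> /(ovoid_partitions_sound subseq_without2) dec_bs.
apply: ovoid_decomposition_cons b_ovoid _; first exact: ovoid_sub.
apply: ovoid_decomposition_cons c_ovoid dec_bs => x xc.
have x_proj : x \in proj_points by apply: ovoid_sub c_ovoid _ xc.
rewrite mem_filter x_proj andbT; move: disjoint_bc; rewrite disjoint_sym.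
by move=> /disjointFr/(_ _)/=; rewrite -!(vec_cone _ x_proj) => -> //; rewrite vec_cone.
Qed.

Lemma partitions_containing_pair :
  [set P in cap_partitions | [set cone b; cone c] \subset P] =
  [set P in [seq partition_of [:: b, c & bs] | bs <- pair_completions b c]].
Proof.
apply/setP => P; rewrite [LHS]in_set [RHS]in_set subUset !sub1set.
apply/and3P/mapP; last first.
  move=> [bs /pair_completion_decomposition/partition_of_cap_partitions cap_P ->].
  by split=> //; apply: mem_partition_of; rewrite !inE eqxx ?orbT.
move=> [cap_P bP cP]; have [P0 part_b] := cap_partition_without cap_P b_ovoid bP.
have bc : cone c != cone b.
  by apply: contraTneq disjoint_bc => ->; rewrite -setI_eq0 setIid -card_gt0 card_ovoid.
have cPb : cone c \in P :\ [set 0] :\ cone b.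
  rewrite !inE bc cP andbT.
  by have /andP[/maxcap_neq_set1->] := centered_cap_ovoid c_ovoid.
have /and3P[c_proj _ _] := c_ovoid.
have := cone_partitionD1 part_b cPb; rewrite rays_cone //.
move=> /(ovoid_partitions_complete subseq_without2)[bs bs_bc bs_eq]; exists bs => //.
rewrite /partition_of !cones_cons -bs_eq !setD1K // !inE bP andbT.
by have /andP[/maxcap_neq_set1->] := centered_cap_ovoid b_ovoid.
Qed.

Lemma uniq_partitions_containing_pair :
    uniq (map (head [::]) (pair_completions b c)) ->
  uniq [seq partition_of [:: b, c & bs] | bs <- pair_completions b c].
Proof.
pose first_block P := rays (pblock P (vec (head 0 R))).
move=> uniq_heads; apply: (map_uniq (f := first_block)); rewrite -map_comp.
suff /eq_in_map -> : {in pair_completions b c, forall bs,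
    first_block (partition_of [:: b, c & bs]) = head [::] bs} by [].
move=> bs bs_bc; have /flatten_mapP[d d_R /mapP[ds _ bs_eq]] := bs_bc.
have /andP[ov_d qd] : ovoid_in R d && (head 0 R \in d).
  by rewrite -mem_ovoids_at_head // (subseq_uniq subseq_without2 proj_points_uniq).
have dec_bs := pair_completion_decomposition bs_bc.
have /and4P[part_bs _ _ _] := is_cap_partition_of dec_bs.
have q_proj : head 0 R \in proj_points.
  by apply: (mem_subseq subseq_without2); apply: ovoid_sub ov_d _ qd.
rewrite /first_block (def_pblock (partition_trivIset part_bs) (B := cone d)) ?vec_cone //.
  have /and3P[d_R' _ _] := ov_d; rewrite bs_eq rays_cone //.
  exact: subseq_trans d_R' subseq_without2.
by apply: mem_partition_of; rewrite bs_eq !inE eqxx !orbT.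
Qed.

Lemma card_partitions_containing_pair k : completable_ovoids k b c ->
  #|[set P in cap_partitions | [set cone b; cone c] \subset P]| = k.
Proof.
case/andP=> /eqP <- /uniq_partitions_containing_pair/card_uniqP card_L.
by rewrite partitions_containing_pair cardsE card_L size_map.
Qed.

Lemma completable_pair_cones k l :
  completable_ovoids k b c -> completable_pair l (cone b) (cone c) = (k == l).
Proof.
move=> compl_bc; rewrite /completable_pair disjoint_bc.
rewrite (card_partitions_containing_pair compl_bc).
have /andP[-> anchor_b] := centered_cap_ovoid b_ovoid.
have /andP[-> anchor_c] := centered_cap_ovoid c_ovoid.
have -> // : [exists a, is_anchor a (cone b) && is_anchor a (cone c)].
by apply/existsP; exists 0; rewrite anchor_b.
Qed.

End PairCompletions.

(** * The two classes *)

Lemma completable_partner k P X :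
    splits_into_completable_pairs k P -> X \in P -> is_maxcap X ->
  exists2 Y, Y \in P & completable_pair k X Y.
Proof.
have completable_sym Y Z : completable_pair k Y Z -> completable_pair k Z Y.
  move=> /and5P[max_Y max_Z disj /existsP[a /andP[aY aZ]] card_YZ].
  apply/and5P; split; rewrite 1?disjoint_sym 1?setUC //.
  by apply/existsP; exists a; rewrite aY aZ.
move=> [a [Y [Z [V [W [_ P_eq YZ VW]]]]]] XP max_X.
have mem_P T : T \in [:: Y; Z; V; W] -> T \in P.
  by rewrite P_eq !inE => /or4P[] ->; rewrite ?orbT.
move: XP; rewrite {1}P_eq !inE (negPf (maxcap_neq_set1 _ max_X)) /=.
case/orP=> [/orP[/orP[]|]|] /eqP X_eq.
- by exists Z; rewrite ?X_eq // mem_P ?inE ?eqxx ?orbT.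
- by exists Y; rewrite ?X_eq; [rewrite mem_P ?inE ?eqxx | apply: completable_sym].
- by exists W; rewrite ?X_eq // mem_P ?inE ?eqxx ?orbT.
by exists V; rewrite ?X_eq; [rewrite mem_P ?inE ?eqxx ?orbT | apply: completable_sym].
Qed.

Section SplitType.

Variables (bs : seq (seq point)) (k : nat).
Hypotheses (bs_decomp : full_decomposition bs) (bs_type : split_type k bs).

Let b i := nth [::] bs i.

Lemma size_split_type : size bs = 4%N.
Proof. by have /and5P[/eqP] := bs_type. Qed.

Lemma block_ovoid i : (i < 4)%N -> is_ovoid (b i).
Proof.
move=> lt_i; have /andP[/allP ov_bs _] := bs_decomp.
by rewrite ov_bs // mem_nth ?size_split_type.
Qed.

Lemma partition_of_blocks :
  partition_of bs = [set [set 0]; cone (b 0); cone (b 1); cone (b 2); cone (b 3)].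
Proof.
rewrite /b; have := size_split_type.
case: (bs) => [|b0 [|b1 [|b2 [|b3 [|? ?]]]]] // _.
by apply/setP => X; rewrite !inE !orbA.
Qed.

Lemma uniq_cones : uniq (map cone bs).
Proof.
apply/card_uniqP; rewrite size_map size_split_type -cardsE.
by have /andP[_ /and3P[_ /eqP-> _]] := bs_decomp.
Qed.

Lemma completable_blocks (l m i j : nat) :
    (i < 4)%N -> (j < 4)%N -> i != j -> completable_ovoids l (b i) (b j) ->
  completable_pair m (cone (b i)) (cone (b j)) = (l == m).
Proof.
move=> lt_i lt_j ij; apply: completable_pair_cones; rewrite ?block_ovoid //.
have /and4P[/partition_trivIset/trivIsetP disj _ _ _] := is_cap_partition_of bs_decomp.
apply: disj; try by apply/mem_partition_of/mem_nth; rewrite size_split_type.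
by rewrite -!(nth_map [::] set0 cone) ?nth_uniq ?uniq_cones ?size_map ?size_split_type.
Qed.

Lemma split_type_splits : splits_into_completable_pairs k (partition_of bs).
Proof.
have /and5P[_ type01 type23 _ _] := bs_type.
exists 0, (cone (b 0)), (cone (b 1)), (cone (b 2)), (cone (b 3)).
split; [exact: is_cap_partition_of | exact: partition_of_blocks | |].
  by rewrite (@completable_blocks k) ?eqxx.
by rewrite (@completable_blocks k) ?eqxx.
Qed.

Lemma split_type_unique l :
  splits_into_completable_pairs l (partition_of bs) -> l \in [:: k; 6%N].
Proof.
have /and5P[_ type01 _ type02 type03] := bs_type.
have /andP[max_b0 _] := centered_cap_ovoid (block_ovoid (isT : 0 < 4)%N).
have b0_bs : cone (b 0) \in partition_of bs.
  by apply/mem_partition_of/mem_nth; rewrite size_split_type.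
move=> /completable_partner/(_ b0_bs max_b0)[Y YP b0Y].
have /and5P[_ max_Y disj _ _] := b0Y.
move: YP; rewrite partition_of_blocks !inE (negPf (maxcap_neq_set1 _ max_Y)) /=.
case/orP=> [/orP[/orP[]|]|] /eqP Y_eq; rewrite Y_eq in b0Y disj.
- by move: disj; rewrite -setI_eq0 setIid -cards_eq0 (card_maxcap max_b0).
- by rewrite (@completable_blocks k) // in b0Y; rewrite eq_sym b0Y.
- by rewrite (@completable_blocks 6) // in b0Y; rewrite [l == 6]eq_sym b0Y orbT.
by rewrite (@completable_blocks 6) // in b0Y; rewrite [l == 6]eq_sym b0Y orbT.
Qed.

End SplitType.

Lemma maps_blocks_class (m : mat) (bs cs : seq (seq point)) :
    full_decomposition bs -> full_decomposition cs ->
    mat_inj m -> maps_blocks m bs cs ->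
  partition_of cs \in Aff43_class (partition_of bs).
Proof.
move=> dec_bs dec_cs /mat_affine[s s_aff s_eq] m_bs_cs; apply/orbitP; exists s => //.
apply/eqP; rewrite eqEcard card_imset; last exact/imset_inj/perm_inj.
rewrite !(card_cap_partition (is_cap_partition_of _)) // andbT.
apply/subsetP => _ /imsetP[X X_bs ->].
have s_set0 : ('P^*)%act [set 0] s = [set 0].
  have := s_eq 0; rewrite vec_mat_apply raddf0 mulmx0 => s0.
  by rewrite -[in RHS]s0 -imset_set1.
move: X_bs; rewrite !inE => /orP[/eqP-> | /mapP[b b_bs ->]].
  by rewrite s_set0 eqxx.
move: m_bs_cs; rewrite /maps_blocks lazy_allE => /allP/(_ b b_bs).
rewrite lazy_hasE => /hasP[c c_cs m_bc].
have /andP[/allP ov_bs _] := dec_bs; have /andP[/allP ov_cs _] := dec_cs.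
have -> : ('P^*)%act (cone b) s = cone c.
  apply: maps_into_cone s_eq m_bc _.
  by rewrite (card_ovoid (ov_bs b b_bs)) (card_ovoid (ov_cs c c_cs)).
by rewrite map_f ?orbT.
Qed.

Lemma cap_partition_class_std P : P \in cap_partitions ->
  exists2 bs, bs \in ovoid_partitions 3 (without proj_points std_ovoid) &
    partition_of (std_ovoid :: bs) \in Aff43_class P.
Proof.
move=> cap_P; have /[1!inE] /existsP[a] := cap_P.
move=> /and4P[_ _ /eqP card_P /forall_inP caps_P].
have /card_gt0P[X XP] : (0 < #|P :\ [set a]|)%N by rewrite card_P.
have /andP[max_X anchor_X] := caps_P X XP.
have /orbitP[s s_aff sX] := maxcap_orbit max_X anchor_X.
have cap_sP : ('P^*^*)%act P s \in cap_partitions by rewrite mem_cap_partitions_act.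
have std_sP : cone std_ovoid \in ('P^*^*)%act P s.
  by rewrite -sX mem_set_act; case/setD1P: XP.
have [bs bs_std bs_eq] := cap_partition_completion cap_sP std_ovoidP std_sP.
by exists bs; [exact: bs_std | rewrite -bs_eq; apply: mem_orbit].
Qed.

Lemma std_decomposition (bs : seq (seq point)) :
  bs \in ovoid_partitions 3 (without proj_points std_ovoid) ->
  full_decomposition (std_ovoid :: bs).
Proof.
move/(ovoid_partitions_sound (without_subseq _ _)).
by apply: ovoid_decomposition_cons std_ovoidP; apply: ovoid_sub std_ovoidP.
Qed.

Definition single_model : {set {set AG43}} :=
  partition_of (std_ovoid :: single_completion).

Definition double_model : {set {set AG43}} :=
  partition_of (std_ovoid :: double_completion).

Lemma single_decomposition : full_decomposition (std_ovoid :: single_completion).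
Proof. by have /and3P[/std_decomposition] := std_completions_table. Qed.

Lemma double_decomposition : full_decomposition (std_ovoid :: double_completion).
Proof. by have /and3P[_ /std_decomposition] := std_completions_table. Qed.

Lemma Aff43_class_sym P (Q : {set {set AG43}}) :
  (P \in Aff43_class Q) = (Q \in Aff43_class P).
Proof. exact: (orbit_sym _ Aff43_group). Qed.

Lemma Aff43_class_eq P (Q : {set {set AG43}}) :
  P \in Aff43_class Q -> Aff43_class P = Aff43_class Q.
Proof. by move/(orbit_eqP (G := Aff43_group)). Qed.

Lemma cap_partitions_cover P : P \in cap_partitions ->
  P \in Aff43_class single_model \/ P \in Aff43_class double_model.
Proof.
move=> /cap_partition_class_std[bs bs_std bs_P].
rewrite ![P \in _]Aff43_class_sym -(Aff43_class_eq bs_P).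
have dec_bs := std_decomposition bs_std.
have /and3P[_ _ /allP/(_ bs bs_std)] := std_completions_table.
rewrite lazy_hasE => /hasP[m]; rewrite mem_filter => /andP[m_inj _].
rewrite lazy_hasE => /hasP[cs]; rewrite !inE => /orP[] /eqP-> m_bs.
  left; exact: maps_blocks_class dec_bs single_decomposition m_inj m_bs.
right; exact: maps_blocks_class dec_bs double_decomposition m_inj m_bs.
Qed.

Lemma Aff43_class_splits k P (Q : {set {set AG43}}) :
  P \in Aff43_class Q ->
  splits_into_completable_pairs k Q -> splits_into_completable_pairs k P.
Proof. by case/orbitP => s s_aff <-; apply: splits_aff. Qed.

Lemma Aff43_class_cap_partitions P (Q : {set {set AG43}}) :
  P \in Aff43_class Q -> (P \in cap_partitions) = (Q \in cap_partitions).
Proof. by case/orbitP => s s_aff <-; apply: mem_cap_partitions_act. Qed.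

Lemma mem_class_split_type k l (bs cs : seq (seq point)) P :
    full_decomposition bs -> split_type k bs ->
    full_decomposition cs -> split_type l cs -> k \notin [:: l; 6%N] ->
    (P \in cap_partitions ->
       P \in Aff43_class (partition_of bs) \/ P \in Aff43_class (partition_of cs)) ->
  P \in Aff43_class (partition_of bs) <->
  P \in cap_partitions /\ splits_into_completable_pairs k P.
Proof.
move=> dec_bs type_bs dec_cs type_cs kNl cover_P; split=> [P_bs | [cap_P split_P]].
  rewrite (Aff43_class_cap_partitions P_bs) partition_of_cap_partitions //; split=> //.
  exact: Aff43_class_splits P_bs (split_type_splits dec_bs type_bs).
have [//|] := cover_P cap_P; rewrite Aff43_class_sym => /Aff43_class_splits/(_ split_P).
by move/(split_type_unique dec_cs type_cs); rewrite (negPf kNl).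
Qed.

Lemma mem_single_model_class P :
  P \in Aff43_class single_model <->
  P \in cap_partitions /\ splits_into_completable_pairs 1 P.
Proof.
have /andP[type1 type2] := split_type_table.
apply: mem_class_split_type single_decomposition type1 double_decomposition type2 isT _.
exact: cap_partitions_cover.
Qed.

Lemma mem_double_model_class P :
  P \in Aff43_class double_model <->
  P \in cap_partitions /\ splits_into_completable_pairs 2 P.
Proof.
have /andP[type1 type2] := split_type_table.
apply: mem_class_split_type double_decomposition type2 single_decomposition type1 isT _.
by move=> /cap_partitions_cover[]; [right | left].
Qed.

Lemma cap_partition_classesE :
  cap_partition_classes = [set Aff43_class single_model; Aff43_class double_model].
Proof.
apply/setP => E; rewrite in_set2; apply/imsetP/orP => [[P cap_P ->] | ].
  by have [/Aff43_class_eq->|/Aff43_class_eq->] := cap_partitions_cover cap_P;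
     rewrite eqxx; [left | right].
by case=> /eqP->; [exists single_model | exists double_model];
   rewrite ?partition_of_cap_partitions ?single_decomposition ?double_decomposition.
Qed.

Lemma model_classes_neq : Aff43_class single_model != Aff43_class double_model.
Proof.
apply/eqP => classes_eq.
have : single_model \in Aff43_class single_model by apply: orbit_refl.
rewrite classes_eq => /mem_double_model_class[_].
have /andP[type1 _] := split_type_table.
by move/(split_type_unique single_decomposition type1).
Qed.

Local Close Scope ring_scope.

Theorem theorem3p10 :
  #|cap_partition_classes| = 2 /\
  (forall P : {set {set AG43}}, P \in cap_partitions ->
     splits_into_completable_pairs 1 P \/ splits_into_completable_pairs 2 P) /\
  (exists E1 E2 : {set {set {set AG43}}},
     cap_partition_classes = [set E1; E2] /\
     (forall P : {set {set AG43}},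
        P \in E1 <->
        P \in cap_partitions /\ splits_into_completable_pairs 1 P) /\
     (forall P : {set {set AG43}},
        P \in E2 <->
        P \in cap_partitions /\ splits_into_completable_pairs 2 P)).
Proof.
split; last split.
- by rewrite cap_partition_classesE cards2 model_classes_neq.
- move=> P /cap_partitions_cover[/mem_single_model_class | /mem_double_model_class] [_].
    by left.
  by right.
exists (Aff43_class single_model), (Aff43_class double_model).
split; first exact: cap_partition_classesE.
split; [exact: mem_single_model_class | exact: mem_double_model_class].
Qed.
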